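(* Let $\lambda$ be a partition of $n$ and let $1\le k\le n$. Then $$\widehat{\alpha_k2^{\alpha}}(\lambda)=\frac{n!}{d_\lambda}\,a_{\lambda,k}\,I_\lambda,$$ where $$a_{\lambda,k}=\frac{2}{k}\begin{cases}(a-b+1)\cdot(-1)^{\mathrm{ht}(\lambda\setminus[a,b])+1} & \text{if there exists a partition } [a,b] \text{ of } n-k \text{ such that } \lambda\setminus[a,b] \text{ is a border strip},\\ 0 & \text{otherwise.}\end{cases}$$
   Context: For a permutation $\pi\in\mathrm{Sym}_n$, $\alpha_k(\pi)$ is the number of cycles of length $k$ in $\pi$ and $\alpha(\pi)=\sum_i\alpha_i(\pi)$ is the total number of cycles. For a partition $\lambda$ of $n$, $R_\lambda:\mathrm{Sym}_n\to\mathrm{GL}(V_\lambda)$ is the irreducible representation of $\mathrm{Sym}_n$ corresponding to $\lambda$, $d_\lambda=\dim V_\lambda$, and $I_\lambda$ is the identity matrix of $V_\lambda$. For $f:\mathrm{Sym}_n\to\mathbb{C}$, $\widehat f(\lambda)=\sum_{\pi\in\mathrm{Sym}_n}f(\pi)R_\lambda(\pi)$. Partitions are identified with Young diagrams. That $[a,b]$ is a partition of $n-k$ means $a\ge b\ge0$ and $a+b=n-k$ (when $b=0$, $[a,b]$ means $[a]$). The authors remark, immediately after the statement, that $a$ and $b$ are uniquely defined by $\lambda$ and $k$ if they exist. A skew diagram is the set difference $\lambda\setminus\mu$ of two Young diagrams with $\mu\subseteq\lambda$; a border strip is a connected skew diagram (connected through edges of boxes) which does not contain a $2\times2$ square. The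 height $\mathrm{ht}$ of a skew diagram is the number of its rows.
   Formalization: The pair [a,b] need not be unique (λ=(2,1), k=1 allows [2] and [1,1]; the true coefficient is 8, each pair alone gives 6 or 2), so a_{λ,k} is taken as 2/k times the sum of the printed term over all suitable [a,b]; where the pair is unique or absent this is the printed formula. *)

(* Defs.v *)
From HB Require Import structures.
From mathcomp Require Import all_boot all_order all_algebra all_fingroup.
From mathcomp Require Import mxrepresentation.

Set Implicit Arguments.
Unset Strict Implicit.
Unset Printing Implicit Defensive.

Import GroupScope Order.TTheory GRing.Theory Num.Theory.
Local Open Scope ring_scope.

(* A partition is the weakly decreasing list of its (positive) parts. *)
Definition is_partition (n : nat) (la : seq nat) : bool :=
  [&& sorted geq la, 0%N \notin la & sumn la == n].

Definition alphak (n k : nat) (s : 'S_n) : nat :=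
  #|[set c in porbits s | #|c| == k]|.

Definition alpha (n : nat) (s : 'S_n) : nat := #|porbits s|.

Definition fourier (F : fieldType) (n d : nat) (f : 'S_n -> F)
    (R : mx_representation F [set: 'S_n] d) : 'M[F]_d :=
  \sum_(s : 'S_n) f s *: R s.

(* The tableau used here is the row-reading one: its rows are filled
   successively with 0, 1, ..., n - 1, so that the entry i lies in row
   [reshape_index la i] and column [reshape_offset la i]. *)
Definition row_stab (n : nat) (la : seq nat) : {set 'S_n} :=
  [set s : 'S_n | [forall i, reshape_index la (s i) == reshape_index la i]].

Definition col_stab (n : nat) (la : seq nat) : {set 'S_n} :=
  [set s : 'S_n | [forall i, reshape_offset la (s i) == reshape_offset la i]].

(* The Young symmetrizer, as an element of the matrix group ring. *)
Definition young_symmetrizer (F : fieldType) (n : nat) (la : seq nat) :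
    'M[F]_#|[set: 'S_n]| :=
  let aG := regular_repr F [set: 'S_n] in
  (\sum_(p in row_stab n la) aG p) *m
  (\sum_(q in col_stab n la) (-1) ^+ q *: aG q).

(* The irreducible representation attached to la: the Specht module, realised
   as the cyclic submodule c F[S_n] of the regular module generated by the
   Young symmetrizer c.  It is trivial for la = [:: n], and the sign
   representation for la = [:: 1; ...; 1]. *)
Definition specht_repr (F : fieldType) (n : nat) (la : seq nat) :=
  submod_repr
    (cyclic_mx_module (regular_repr F [set: 'S_n])
                      (gring_row (young_symmetrizer F n la))).

(* Young diagrams as sets of boxes (row, column), 0-based.  The n x n grid
   contains the whole diagram of any partition of some m <= n.  Trailing zero
   parts are harmless: [:: a; 0] and [:: a] have the same diagram. *)
Definition diagram (n : nat) (la : seq nat) : {set 'I_n * 'I_n} :=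
  [set x : 'I_n * 'I_n | (x.2 < nth 0 la x.1)%N].

Definition box_adj (n : nat) (x y : 'I_n * 'I_n) : bool :=
  ((x.1 == y.1) && ((x.2.+1 == y.2 :> nat) || (y.2.+1 == x.2 :> nat))) ||
  ((x.2 == y.2) && ((x.1.+1 == y.1 :> nat) || (y.1.+1 == x.1 :> nat))).

Definition edge_connected (n : nat) (D : {set 'I_n * 'I_n}) : bool :=
  [forall x in D, forall y in D,
    connect [rel u v | [&& u \in D, v \in D & box_adj u v]] x y].

Definition has_square (n : nat) (D : {set 'I_n * 'I_n}) : bool :=
  [exists x : 'I_n * 'I_n, exists y : 'I_n * 'I_n,
    [&& y.1 == x.1.+1 :> nat, y.2 == x.2.+1 :> nat,
        x \in D, (x.1, y.2) \in D, (y.1, x.2) \in D & y \in D]].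

Definition skew_is_border_strip (n : nat) (la mu : seq nat) : bool :=
  [&& diagram n mu \subset diagram n la,
      edge_connected (diagram n la :\: diagram n mu) &
      ~~ has_square (diagram n la :\: diagram n mu)].

Definition height (n : nat) (D : {set 'I_n * 'I_n}) : nat :=
  #|[set x.1 | x in D]|.

(* [a, b] is a partition of n - k whose removal from la leaves a border strip. *)
Definition strip_pair (n : nat) (la : seq nat) (k : nat)
    (ab : 'I_n.+1 * 'I_n.+1) : bool :=
  [&& (ab.2 <= ab.1)%N, (ab.1 + ab.2 == n - k)%N &
      skew_is_border_strip n la [:: val ab.1; val ab.2]].

Definition strip_term (F : fieldType) (n : nat) (la : seq nat)
    (ab : 'I_n.+1 * 'I_n.+1) : F :=
  (ab.1 - ab.2 + 1)%N%:R *
  (-1) ^+ (height (diagram n la :\: diagram n [:: val ab.1; val ab.2]) + 1).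

(* The coefficient a_{la,k}.  When exactly one pair (a, b) is suitable, or none,
   it is the usual two-case expression (see the two lemmas below).  A second
   pair can only occur when la has exactly two rows, e.g. [2] and [1, 1] for
   la = [2, 1] and k = 1; the contributions then have to be added, no single
   one of them giving the right value. *)
Definition acoef (F : fieldType) (n : nat) (la : seq nat) (k : nat) : F :=
  2 / k%:R *
  \sum_(ab : 'I_n.+1 * 'I_n.+1 | strip_pair la k ab) strip_term F la ab.

Lemma acoef_unique (F : fieldType) (n : nat) (la : seq nat) (k : nat)
    (ab : 'I_n.+1 * 'I_n.+1) :
  strip_pair la k ab -> (forall ab', strip_pair la k ab' -> ab' = ab) ->
  acoef F n la k = 2 / k%:R * strip_term F la ab.
Proof.
move=> hab uab; rewrite /acoef (bigD1 ab) //= big1 ?addr0 //.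
by move=> ab' /andP[/uab-> /eqP].
Qed.

Lemma acoef_none (F : fieldType) (n : nat) (la : seq nat) (k : nat) :
  (forall ab : 'I_n.+1 * 'I_n.+1, ~~ strip_pair la k ab) ->
  acoef F n la k = 0.
Proof.
by move=> h; rewrite /acoef big_pred0 ?mulr0 // => ab; apply/negbTE.
Qed.

(* Main.v *)
(* By a lemma of von Neumann the Young symmetrizer c = ab satisfies c g c in Cc for
   every g, so a central element z = sum_s f(s) s acts on the module generated by c
   by the scalar sum_s f(s) c(s^-1), and c^2 = (n!/d) c.  Averaging c over conjugates
   gives the character Y of that module.  With n + 1 variables, let
   psi(x) = [X^(delta + la)] (a_delta p_x) be Frobenius' expression for it.  Both
   functions are real of norm 1 and <Y, psi> = 1: the norm of psi is computed by
   expanding it in permutation characters and using Pieri's rule, and <Y, psi> comes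
   from the vanishing of b a_w for words w that the diagram of la does not dominate.
   Hence Y = psi.

   The Frobenius characteristic of alpha_k 2^alpha is
   (2/k) p_k sum_(a+b=n-k) h_a h_b = (2/k) p_k sum_(a>=b) (a - b + 1) s_[a,b],
   and the Murnaghan-Nakayama rule extracts the coefficient of s_la. *)
Require Import Defs.
From HB Require Import structures.
From mathcomp Require Import all_boot all_order all_algebra all_fingroup.
From mathcomp Require Import mxrepresentation.
From mathcomp Require Import mpoly zify.

Set Implicit Arguments.
Unset Strict Implicit.
Unset Printing Implicit Defensive.

Import GroupScope Order.TTheory GRing.Theory Num.Theory.
Local Open Scope ring_scope.

(** * Words and their stabilizers *)

Section Words.
Variable n : nat.
Implicit Types (x s : 'S_n).

(** A permutation x enters every computation through the words it fixes: [2 ^ alpha x] counts the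
    fixed words on two letters, [cycle_poly x] records the contents of those on n + 1 letters, and
    the row and column groups of the tableau are word stabilizers. Each characteristic is then a
    double count of pairs of a permutation and a fixed word, grouped by content through
    orbit-stabilizer. Symmetric functions occur only multiplied by the alternant of [delta].
    Antisymmetric polynomials are determined by their coefficients at strictly decreasing exponents,
    and at those places an alternant has a single coefficient 1, so the rules of Pieri and
    Murnaghan-Nakayama become statements about coefficients. In the constant, 1/k comes from the
    uniform law of the cycle length of a point in a Young subgroup, 2 from the two letters, and a -
    b + 1 from the number of products h_i h_(n-k-i) that contain s_[a,b]. With n + 1 variables the
    index type is never empty and has two rows as soon as n > 0. *)

Definition content (T : finType) (w : {ffun 'I_n -> T}) t :=
  #|[set i | w i == t]|.

Definition wstab (T : finType) (w : {ffun 'I_n -> T}) : {set 'S_n} :=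
  [set x : 'S_n | [forall i, w (x i) == w i]].

Definition wact (T : finType) (w : {ffun 'I_n -> T}) (s : 'S_n) :
  {ffun 'I_n -> T} := [ffun i => w (s i)].

Lemma wstabP (T : finType) (w : {ffun 'I_n -> T}) x :
  reflect (forall i, w (x i) = w i) (x \in wstab w).
Proof. by rewrite inE; apply: (iffP forallP) => h i; apply/eqP. Qed.

Lemma wstabM (T : finType) (w : {ffun 'I_n -> T}) x s :
  x \in wstab w -> s \in wstab w -> (x * s)%g \in wstab w.
Proof.
by move=> /wstabP hx /wstabP hs; apply/wstabP=> i; rewrite permM hs hx.
Qed.

Lemma wstabV (T : finType) (w : {ffun 'I_n -> T}) x :
  x \in wstab w -> (x^-1)%g \in wstab w.
Proof. by move=> /wstabP hx; apply/wstabP=> i; rewrite -{2}[i](permKV x) hx. Qed.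

Lemma wstab_tperm (T : finType) (w : {ffun 'I_n -> T}) i j :
  w i = w j -> tperm i j \in wstab w.
Proof. by move=> h; apply/wstabP=> a; case: tpermP => // ->. Qed.

Lemma wstabJ (T : finType) (w : {ffun 'I_n -> T}) x s :
  (x \in wstab (wact w s)) = ((x ^ s)%g \in wstab w).
Proof.
apply/wstabP/wstabP => h i.
  have := h (s^-1%g i); rewrite !ffunE permKV => <-.
  by rewrite -{1}[i](permKV s) permJ.
by rewrite !ffunE -permJ h.
Qed.

Lemma card_wstab_gt0 (T : finType) (w : {ffun 'I_n -> T}) : (0 < #|wstab w|)%N.
Proof. by apply/card_gt0P; exists 1%g; apply/wstabP=> i; rewrite perm1. Qed.

Lemma content_wact (T : finType) (w : {ffun 'I_n -> T}) s :
  content (wact w s) =1 content w.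
Proof.
move=> t; rewrite /content.
have -> : [set i | wact w s i == t] = s @^-1: [set i | w i == t].
  by apply/setP=> i; rewrite !inE ffunE.
by rewrite -im_permV card_imset //; apply: perm_inj.
Qed.

Lemma content_transitive (T : finType) (w w' : {ffun 'I_n -> T}) :
  content w =1 content w' -> exists s, w' = wact w s.
Proof.
move=> h.
have cnt (v : {ffun 'I_n -> T}) t : count_mem t [tuple v i | i < n] = content v t.
  rewrite /content cardsE cardE /enum_mem size_filter -enumT /=.
  by rewrite count_map; apply: eq_count => i.
have /tuple_permP[p hp] : perm_eq [tuple w' i | i < n] [tuple w i | i < n].
  by apply/allP=> t _; rewrite /= !cnt h.
exists p; apply/ffunP=> i; rewrite ffunE.
have := congr1 (fun t : n.-tuple T => tnth t i) (val_inj hp); by rewrite !tnth_mktuple.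
Qed.

Lemma content_exists (T : finType) (M : T -> nat) :
  (\sum_t M t)%N = n -> exists w : {ffun 'I_n -> T}, content w =1 M.
Proof.
move=> hM; pose s := flatten [seq nseq (M t) t | t <- enum T].
have hs : size s == n.
  rewrite size_flatten /shape -map_comp sumnE big_map big_enum /= -hM.
  by apply/eqP/eq_bigr=> t _; rewrite /= size_nseq.
exists [ffun i => tnth (Tuple hs) i] => t; rewrite /content.
have -> : M t = count_mem t (Tuple hs).
  rewrite /= count_flatten -map_comp sumnE big_map big_enum /= (bigD1 t) //=.
  rewrite count_nseq /= eqxx mul1n big1 ?addn0 // => u hu.
  by rewrite count_nseq /= (negbTE hu).
rewrite -[in RHS](map_tnth_enum (Tuple hs)) count_map cardsE cardE.
rewrite [in LHS]/enum_mem size_filter -enumT; apply: eq_count => i /=.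
by rewrite unfold_in /= ffunE.
Qed.

(** Both sides equal the sum, over all s, of the sum of F over the stabilizer of [wact w0 s]. These
    stabilizers are conjugate, so the inner sum does not depend on s, while each word of the orbit
    is reached by a coset of [wstab w0]. *)
Lemma orbit_sum (V : nmodType) (T : finType) (w0 : {ffun 'I_n -> T})
    (F : 'S_n -> V) (hF : forall x s, F (x ^ s)%g = F x) :
  (\sum_(w : {ffun 'I_n -> T} | [forall t, content w t == content w0 t])
    \sum_(x in wstab w) F x) *+ #|wstab w0|
  = (\sum_(x in wstab w0) F x) *+ n`!.
Proof.
have stabF s : \sum_(x in wstab (wact w0 s)) F x = \sum_(x in wstab w0) F x.
  rewrite [RHS](reindex_inj (conjg_inj s)) /=.
  by apply: eq_big => x; rewrite ?wstabJ ?hF.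
transitivity (\sum_(s : 'S_n) \sum_(x in wstab (wact w0 s)) F x); last first.
  rewrite (eq_bigr _ (fun s _ => stabF s)) sumr_const; congr (_ *+ _).
  by rewrite -card_Sn; apply: eq_card.
rewrite (partition_big (wact w0)
  (fun w => [forall t, content w t == content w0 t])) /=; last first.
  by move=> s _; apply/forallP=> t; rewrite content_wact.
rewrite -sumrMnl; apply: eq_bigr => w /forallP hw.
have [|s0 hs0] := @content_transitive _ w0 w; first by move=> t; apply/esym/eqP.
rewrite [RHS](eq_bigr (fun=> \sum_(x in wstab w) F x)); last by move=> s /eqP ->.
rewrite sumr_const; congr (_ *+ _); rewrite -[LHS](card_imset _ (mulgI s0)).
apply: eq_card => s; apply/imsetP/idP => [[x /wstabP hx ->]|hs].
  change (wact w0 (s0 * x) == w); apply/eqP; rewrite hs0.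
  by apply/ffunP=> i; rewrite !ffunE permM hx.
have /eqP {}hs : wact w0 s == w by [].
exists (s0^-1 * s)%g; last by rewrite mulKVg.
apply/wstabP=> i; rewrite permM.
by have /ffunP/(_ (s0^-1 i)%g) := etrans hs hs0; rewrite !ffunE permKV.
Qed.

(** A fixed word is constant on cycles, hence amounts to the set of cycles that carry the letter
    true. This is how the weight 2^alpha becomes a permutation character. *)
Lemma card_fixed_bool_words x :
  #|[set w : {ffun 'I_n -> bool} | x \in wstab w]| = (2 ^ alpha x)%N.
Proof.
rewrite /alpha -card_powerset.
pose f (A : {set {set 'I_n}}) : {ffun 'I_n -> bool} := [ffun i => porbit x i \in A].
rewrite -(@card_in_imset _ _ f); last first.
  move=> A B; rewrite !inE => hA hB /ffunP hf; apply/setP=> c.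
  have [/imsetP[i _ ->]|hc] := boolP (c \in porbits x).
    by have := hf i; rewrite !ffunE.
  by rewrite !(contraNF (subsetP _ _) hc).
apply: eq_card => w; apply/idP/imsetP => [|[A _ ->]].
  rewrite inE => /wstabP hw.
  exists [set c in porbits x | [exists i, (porbit x i == c) && w i]].
    by rewrite inE; apply/subsetP=> c; rewrite inE => /andP[].
  apply/ffunP=> i; rewrite ffunE inE imset_f //=; apply/idP/existsP.
    by move=> wi; exists i; rewrite eqxx.
  move=> [j /andP[]]; rewrite eq_porbit_mem => /porbitP[m ->].
  by elim: m => [|m IH]; rewrite ?perm1 // expgSr permM hw.
rewrite inE; apply/wstabP=> i; rewrite !ffunE.
by have := porbit_perm x 1 i; rewrite expg1 => ->.
Qed.

Lemma sum_card_porbit k x :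
  (\sum_(i : 'I_n) (#|porbit x i| == k) = k * alphak k x)%N.
Proof.
rewrite -big_mkcond /= (partition_big (porbit x)
  (mem [set c in porbits x | #|c| == k])) /=; last first.
  by move=> i hi; rewrite inE imset_f.
rewrite /alphak mulnC -sum_nat_const; apply: eq_bigr => c.
rewrite inE => /andP[/imsetP[i0 _ ->] /eqP hc].
rewrite -[RHS]hc -sum1_card; apply: eq_bigl => i.
rewrite eq_porbit_mem; case: (boolP (i \in _)); last by rewrite andbF.
by rewrite -eq_porbit_mem => /eqP ->; rewrite hc eqxx.
Qed.

Lemma porbit_closed x i (S : {set 'I_n}) :
  i \in S -> (forall a, a \in S -> x a \in S) -> porbit x i \subset S.
Proof.
move=> iS hS; apply/subsetP=> _ /porbitP[m ->].
by elim: m => [|m IH]; rewrite ?perm1 // expgSr permM hS.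
Qed.

Lemma porbit_step x i a : a \in porbit x i -> x a \in porbit x i.
Proof. by move=> /porbitP[m ->]; rewrite -permM -expgSr mem_porbit. Qed.

(** The transposition inserts the fixed point i just before j in the cycle of j. *)
Lemma porbit_mul_tperm_fix (y : 'S_n) i j : y i = i -> i != j ->
  porbit (y * tperm i j)%g i = i |: porbit y j.
Proof.
move=> yi ij; set x := (y * _)%g.
have xi : x i = j by rewrite permM yi tpermL.
have niy : i \notin porbit y j.
  apply/negP; rewrite porbit_sym => /porbitP[m].
  by rewrite permX_fix // => /eqP; rewrite eq_sym (negbTE ij).
apply/eqP; rewrite eqEsubset; apply/andP; split.
  apply: porbit_closed; first by rewrite !inE eqxx.
  move=> a; rewrite !inE => /orP[/eqP ->|ha].
    by rewrite xi porbit_id orbT.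
  by rewrite permM; have := porbit_step ha; case: tpermP => [->|->|_ _ ->];
    rewrite ?porbit_id ?eqxx ?orbT.
rewrite subUset sub1set porbit_id /=.
apply: (@subset_trans _ _ (porbit x i :\ i)); last exact: subsetDl.
apply: porbit_closed; first by rewrite !inE eq_sym ij -xi porbit_step ?porbit_id.
move=> a; rewrite !inE => /andP[nai ha].
have := porbit_step ha; rewrite permM.
have yai : y a != i by rewrite -{1}yi (inj_eq perm_inj).
rewrite yai; case: tpermP => [/eqP|-> _|_ _ -> //]; first by rewrite (negbTE yai).
by rewrite -xi porbit_step ?porbit_id.
Qed.

(** A letter used at i alone turns the subgroup of [wstab w] fixing i into a word stabilizer again,
    so that inductions stay among such groups. *)
Definition freeze (T : finType) (w : {ffun 'I_n -> T}) (i : 'I_n) :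
    {ffun 'I_n -> option T} :=
  [ffun a => if a == i then None else Some (w a)].

Lemma freeze_stabP (T : finType) (w : {ffun 'I_n -> T}) i y :
  (y \in wstab (freeze w i)) = (y i == i) && (y \in wstab w).
Proof.
apply/wstabP/andP => [h|[/eqP yi /wstabP h] a].
  have yi : y i = i.
    by have := h i; rewrite !ffunE eqxx; case: eqP.
  split; [exact/eqP|apply/wstabP=> a].
  have := h a; rewrite !ffunE.
  case: (altP (a =P i)) => [->|ai]; first by rewrite yi.
  by case: ifP => // _ [].
by rewrite !ffunE h -{1}yi (inj_eq perm_inj).
Qed.

Lemma content_freeze (T : finType) (w : {ffun 'I_n -> T}) i :
  content (freeze w i) (Some (w i)) = (content w (w i)).-1.
Proof.
rewrite /content (cardsD1 i [set a | w a == w i]) inE eqxx add1n /=.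
apply: eq_card => a; rewrite !inE ffunE; case: ifP => //= _.
Qed.

Lemma stab_send (T : finType) (w : {ffun 'I_n -> T}) i j (Q : pred 'S_n) :
    w i = w j ->
  #|[set x in wstab w | (x i == j) && Q (x * tperm i j)%g]|
  = #|[set y in wstab (freeze w i) | Q y]|.
Proof.
move=> wij; rewrite -(card_imset _ (mulIg (tperm i j))).
apply: eq_card => y; rewrite inE freeze_stabP; apply/imsetP/idP.
  move=> [x]; rewrite inE => /andP[hx /andP[/eqP xi hQ]] ->.
  by rewrite permM xi tpermR eqxx hQ wstabM ?wstab_tperm.
move=> /andP[/andP[/eqP yi hy] hQ].
exists (y * tperm i j)%g; last by rewrite -mulgA tperm2 mulg1.
by rewrite inE wstabM ?wstab_tperm //= permM yi tpermL eqxx -mulgA tperm2 mulg1.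
Qed.

Lemma card_freeze (T : finType) (w : {ffun 'I_n -> T}) i :
  (#|wstab (freeze w i)| * content w (w i) = #|wstab w|)%N.
Proof.
rewrite -[RHS]sum1_card (partition_big (fun x : 'S_n => x i)
  (fun j => w j == w i)) /=; last by move=> x /wstabP ->.
rewrite mulnC /content cardsE -sum_nat_const; apply: eq_bigr => j /eqP wj.
have := @stab_send _ w i j predT (esym wj).
have -> : [set y in wstab (freeze w i) | predT y] = wstab (freeze w i).
  by apply/setP=> y; rewrite inE andbT.
move=> <-; rewrite -sum1_card; apply: eq_bigl => x.
by rewrite inE andbT.
Qed.

Lemma card_long_orbit (T : finType) (w : {ffun 'I_n -> T}) i k : (0 < k)%N ->
  (#|[set x in wstab w | #|porbit x i| == k]| * content w (w i)
   = (k <= content w (w i)) * #|wstab w|)%N.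
Proof.
(* The alphabet is generalised because freezing passes from [T] to [option T]. *)
elim: k T w i => // k IH T w i _.
have [->|k0] := posnP k.
  have -> : (1 <= content w (w i))%N.
    by apply/card_gt0P; exists i; rewrite inE.
  rewrite mul1n -(@card_freeze _ w i); congr (_ * _)%N.
  apply: eq_card => x; rewrite freeze_stabP inE andbC; congr (_ && _).
  apply/idP/eqP => [/cards1P[a ha]|xi].
    have := porbit_id x i; have := porbit_step (porbit_id x i).
    by rewrite ha !inE => /eqP -> /eqP.
  apply/cards1P; exists i; apply/setP=> a; rewrite inE; apply/idP/eqP.
    by move=> /porbitP[m ->]; rewrite permX_fix.
  by move=> ->; rewrite porbit_id.
set m := content w (w i).
have -> : #|[set x in wstab w | #|porbit x i| == k.+1]| =
  (\sum_(j | (w j == w i) && (j != i))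
     #|[set y in wstab (freeze w i) | #|porbit y j| == k]|)%N.
  rewrite -[LHS]sum1_card (partition_big (fun x : 'S_n => x i)
    (fun j => (w j == w i) && (j != i))) /=; last first.
    move=> x; rewrite inE => /andP[/wstabP -> h]; rewrite eqxx /=.
    apply: contraTneq h => xi.
    have /subset_leq_card : porbit x i \subset [set i].
      by apply: porbit_closed; rewrite ?inE // => a; rewrite !inE => /eqP ->; rewrite xi.
    by rewrite cards1 => h; rewrite neq_ltn (leq_ltn_trans h) // ltnS.
  apply: eq_bigr => j /andP[/eqP wj ji].
  rewrite -(@stab_send _ w i j (fun y => #|porbit y j| == k) (esym wj)).
  rewrite -sum1_card; apply: eq_bigl => x; rewrite !inE -andbA.
  congr (_ && _); rewrite andbC; case: eqP => //= xi.
  set y := (x * _)%g.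
  have yi : y i = i by rewrite permM xi tpermR.
  have -> : x = (y * tperm i j)%g by rewrite -mulgA tperm2 mulg1.
  rewrite porbit_mul_tperm_fix // 1?eq_sym // cardsU1.
  have -> : i \notin porbit y j.
    apply/negP; rewrite porbit_sym => /porbitP[r].
    by rewrite permX_fix // => /eqP; rewrite (negbTE ji).
  by rewrite add1n eqSS eq_sym.
have [m1|m1] := leqP m 1.
  rewrite big_pred0 => [|j]; first by rewrite mul0n ltnNge (leq_trans m1 k0).
  apply/negP => /andP[/eqP wj ji].
  have : (#|[set i; j]| <= m)%N.
    by apply/subset_leq_card/subsetP => a; rewrite !inE => /orP[] /eqP ->; rewrite ?wj.
  by rewrite cards2 eq_sym ji => /leq_trans/(_ m1).
have mE : m = m.-1.+1 by rewrite prednK // ltnW.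
have cf j : w j == w i -> j != i ->
    content (freeze w i) (freeze w i j) = m.-1.
  by move=> /eqP wj ji; rewrite ffunE (negbTE ji) wj content_freeze.
have m0 : (0 < m.-1)%N by rewrite -ltnS -mE.
apply/eqP; rewrite -(eqn_pmul2r m0); apply/eqP.
rewrite mulnAC big_distrl /=.
rewrite (eq_bigr (fun=> (k <= m.-1) * #|wstab (freeze w i)|)%N); last first.
  by move=> j /andP[wj ji]; rewrite -(cf j wj ji) IH.
rewrite sum_nat_const.
have -> : #|[pred j | (w j == w i) && (j != i)]| = m.-1.
  rewrite /m /content (cardsD1 i) inE eqxx add1n /=.
  by apply: eq_card => a; rewrite !inE andbC.
rewrite -(@card_freeze _ w i) -/m.
by rewrite [in (k < m)%N]mE ltnS; lia.
Qed.

(** A letter of multiplicity m >= k has m places, each lying on a k-cycle with frequency 1/m, so it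
    contributes exactly one stabilizer order; smaller multiplicities contribute nothing. *)
Lemma sum_alphak_wstab (T : finType) (w : {ffun 'I_n -> T}) k : (0 < k)%N ->
  (k * (\sum_(x in wstab w) alphak k x)
   = #|wstab w| * #|[set t | k <= content w t]|)%N.
Proof.
move=> k0; rewrite big_distrr /=.
rewrite (eq_bigr _ (fun x _ => esym (sum_card_porbit k x))) exchange_big /=.
rewrite (partition_big w predT) //= -sum1_card big_distrr /=.
rewrite [RHS](eq_bigl (fun t => k <= content w t)%N); last by move=> t; rewrite inE.
rewrite [RHS]big_mkcond; apply: eq_bigr => t _ /=.
have [c0|c0] := posnP (content w t).
  rewrite c0 leqNgt k0 /= big_pred0 // => i; apply/negP => /eqP wi.
  by move: c0; rewrite /content (cardsD1 i) inE wi eqxx.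
apply/eqP; rewrite -(eqn_pmul2r c0) big_distrl /=.
rewrite (eq_bigr (fun=> (k <= content w t) * #|wstab w|)%N); last first.
  move=> i /eqP wi; rewrite -wi -card_long_orbit //; congr (_ * _)%N.
  rewrite -big_mkcondr /= sum1_card; by rewrite [RHS]cardsE.
rewrite sum_nat_const /content cardsE; case: ifP; rewrite ?muln1 ?mul1n ?muln0 //.
by rewrite mulnC.
Qed.
End Words.

(** * Alternants and the rules of Pieri and Murnaghan-Nakayama *)

Section Alternants.
Variables (R : numFieldType) (n : nat).
Local Notation L := n.+1.
Local Notation "m # s" := [multinom m (s i) | i < L]
  (at level 40, left associativity, format "m # s").
Implicit Types (u v w m : 'X_{1..L}) (s : 'S_L) (p q : {mpoly R[L]}).

Definition delta : 'X_{1..L} := [multinom (n - i)%N | i < L].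

Definition alternant v : {mpoly R[L]} := \sum_(s : 'S_L) (-1) ^+ s *: 'X_[v#s].

(* The complete symmetric polynomial of degree [k], provided [k <= n]. *)
Definition hsym k : {mpoly R[L]} :=
  \sum_(v : 'X_{1..L < L} | mdeg v == k) 'X_[v].

Definition strict u := forall i j : 'I_L, (i < j)%N -> (u j < u i)%N.

Definition antisymmetric_poly p :=
  forall s m, p@_(m#s) = (-1) ^+ s * p@_m.

(** For u = delta + la and w = delta + mu this says that la/mu is a horizontal strip. *)
Definition interlace u w : bool :=
  (w <= u)%MM && [forall a : 'I_L, forall b : 'I_L, (a < b)%N ==> (u b < w a)%N].

Lemma interlaceP u w :
  reflect ((forall i, w i <= u i)%N /\
           (forall a b : 'I_L, (a < b)%N -> (u b < w a)%N)) (interlace u w).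
Proof.
apply: (iffP andP) => -[h1 h2]; split.
- exact/mnm_lepP.
- by move=> a b ab; have /forallP/(_ a)/forallP/(_ b)/implyP := h2; apply.
- exact/mnm_lepP.
- by apply/forallP=> a; apply/forallP=> b; apply/implyP/h2.
Qed.

Lemma interlace_strict u w : interlace u w -> strict w.
Proof. by move=> /interlaceP[h1 h2] i j /h2; apply: leq_ltn_trans. Qed.

Lemma deltaE (i : 'I_L) : delta i = (n - i)%N.
Proof. by rewrite mnmE. Qed.

Lemma delta_strict : strict delta.
Proof. by move=> i j ij; rewrite !deltaE; have := ltn_ord j; lia. Qed.

Lemma strict_ge_delta u : strict u -> forall i, (delta i <= u i)%N.
Proof.
move=> su i; rewrite deltaE.
have : forall k (i : 'I_L), (i + k = n)%N -> (k <= u i)%N.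
  elim=> // k IH j jk.
  have jn : (j.+1 < L)%N by lia.
  have /IH : (Ordinal jn + k = n)%N by rewrite /=; lia.
  have /su : (j < Ordinal jn)%N by [].
  lia.
by apply; have := ltn_ord i; lia.
Qed.

Lemma mono_ord_id k (g : 'I_k -> 'I_k) :
  (forall a b : 'I_k, (a < b)%N -> (g a < g b)%N) -> forall a, g a = a.
Proof.
have ge (f : 'I_k -> 'I_k) : (forall a b : 'I_k, (a < b)%N -> (f a < f b)%N) ->
    forall (m : nat) (a : 'I_k), a = m :> nat -> (m <= f a)%N.
  move=> hf; elim=> // m IH a am.
  have mk : (m < k)%N by have := ltn_ord a; lia.
  have /IH h : Ordinal mk = m :> nat by [].
  have /hf : (Ordinal mk < a)%N by rewrite am.
  by apply: leq_ltn_trans.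
move=> hg a; apply/val_inj/eqP; rewrite eqn_leq (ge g hg a a) // andbT.
(* The upper bound is the lower bound for the conjugate of g by order reversal. *)
have := ge (fun b => rev_ord (g (rev_ord b))) _ _ (rev_ord a) erefl.
rewrite rev_ordK /=.
have h : forall b c : 'I_k, (b < c)%N ->
    (rev_ord (g (rev_ord b)) < rev_ord (g (rev_ord c)))%N.
  move=> b c bc.
  have /hg : (rev_ord c < rev_ord b)%N by rewrite /=; have := ltn_ord c; lia.
  rewrite /=; have := ltn_ord (g (rev_ord b)); lia.
move=> /(_ h); have := ltn_ord a; have := ltn_ord (g a); lia.
Qed.

Lemma strict_inj u : strict u -> forall i j, u i = u j -> i = j.
Proof.
move=> su i j uij; apply/val_inj; case: (ltngtP i j) => // /su; rewrite uij ltnn //.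
Qed.

Lemma strict_mono u : strict u -> forall i j, (u i < u j)%N = (j < i)%N.
Proof.
move=> su i j; case: (ltngtP j i) => [/su //|/su|/val_inj ->]; last by rewrite ltnn.
by move=> h; rewrite ltnNge (ltnW h).
Qed.

Lemma mcoeff_alternant v m :
  (alternant v)@_m = \sum_(s : 'S_L) (-1) ^+ s * (v#s == m)%:R.
Proof. by rewrite raddf_sum; apply: eq_bigr => s _; rewrite /= mcoeffZ mcoeffX. Qed.

Lemma antisym_alternant v : antisymmetric_poly (alternant v).
Proof.
move=> t m; rewrite !mcoeff_alternant big_distrr /=.
rewrite (reindex_inj (mulgI t)) /=; apply: eq_bigr => s _.
rewrite odd_permM signr_addb -mulrA; congr (_ * (_ * _%:R)).
by rewrite mpermM (inj_eq (@mperm_inj _ t)).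
Qed.

Lemma alternant_strict u v : strict u -> strict v ->
  (alternant v)@_u = (v == u)%:R.
Proof.
move=> su sv; rewrite mcoeff_alternant (bigD1 1%g) //= odd_perm1 expr0 mul1r.
rewrite mperm1 big1 ?addr0 // => s s1; rewrite [_ == u](contraNF _ s1) ?mulr0 //.
move=> /eqP vs; apply/eqP/permP=> i; rewrite perm1.
apply: (@mono_ord_id _ s) => a b ab.
by rewrite -(strict_mono sv); have := su _ _ ab; rewrite -vs !mnmE.
Qed.

Lemma mcoeffM_sub p q u :
  (p * q)@_u = \sum_(w : 'X_{1..L < (mdeg u).+1} | (w <= u)%MM) p@_w * q@_(u - w).
Proof.
rewrite mcoeffM big_mkcond /= -(pair_bigA _ (fun k1 k2 : 'X_{1..L < (mdeg u).+1} =>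
  if u == (k1 + k2)%MM then p@_k1 * q@_k2 else 0)) /= [RHS]big_mkcond /=.
apply: eq_bigr => w _; case: ifP => [wu|nwu].
  have hb : (mdeg (u - w)%MM < (mdeg u).+1)%N by rewrite ltnS mdegB.
  rewrite (bigD1 (BMultinom hb)) //= addmC submK // eqxx big1 ?addr0 //.
  move=> k kn; case: eqP => // uk; case/eqP: kn; apply/val_inj => /=.
  by have := congr1 (fun m => m - w)%MM uk; rewrite addmC addmK.
rewrite big1 // => k _; case: eqP => // uk; move/negP: nwu; case.
by have := lem_addr (bmnm w) (bmnm k); rewrite -uk.
Qed.

Lemma mcoeff_hsym k m : (k <= n)%N -> (hsym k)@_m = (mdeg m == k)%:R.
Proof.
move=> kn; rewrite raddf_sum /=.
have [mk|mk] := eqVneq (mdeg m) k; last first.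
  rewrite big1 // => v /eqP vk; rewrite mcoeffX; case: eqP => // vm.
  by move: mk; rewrite -vm vk eqxx.
have hb : (mdeg m < L)%N by rewrite mk ltnS.
rewrite (bigD1 (BMultinom hb)) /= ?mk // mcoeffX eqxx big1 ?addr0 //.
move=> v /andP[_ vn]; rewrite mcoeffX; case: eqP => // vm.
by case/eqP: vn; apply/val_inj.
Qed.

(* Terms violating the interlacing condition first at index [t] cancel in
   pairs, by exchanging the entries [t] and [t + 1]. *)
Lemma antisym_sum_interlace (F : 'X_{1..L} -> R) u b :
    (forall s m, F (m#s) = (-1) ^+ s * F m) -> strict u ->
  \sum_(w : 'X_{1..L < b} | (w <= u)%MM) F w
  = \sum_(w : 'X_{1..L < b} | interlace u w) F w.
Proof.
move=> hF su.
pose Q t (w : 'X_{1..L}) :=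
  [forall a : 'I_L, forall c : 'I_L, (a < t)%N && (a < c)%N ==> (u c < w a)%N].
have QP t w : reflect
    (forall a c : 'I_L, (a < t)%N -> (a < c)%N -> (u c < w a)%N) (Q t w).
  apply: (iffP forallP) => h a; last first.
    by apply/forallP=> c; apply/implyP=> /andP[]; apply: h.
  by move=> c hat hac; have /forallP/(_ c)/implyP := h a; rewrite hat hac; apply.
suff H t : (t <= n)%N -> \sum_(w : 'X_{1..L < b} | (w <= u)%MM) F w
    = \sum_(w : 'X_{1..L < b} | (w <= u)%MM && Q t w) F w.
  rewrite (H n) //; apply: eq_bigl => w; apply: andb_id2l => _.
  apply/QP/forallP => h a.
    apply/forallP=> c; apply/implyP=> ac; apply: h => //.
    by have := ltn_ord c; lia.
  by move=> c _ ac; have /forallP/(_ c)/implyP := h a; apply.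
elim: t => [_|t IH tn].
  by apply: eq_bigl => w; rewrite (_ : Q 0%N w) ?andbT //; apply/QP.
rewrite IH ?(ltnW tn) // (bigID (fun w : 'X_{1..L < b} => Q t.+1 w)) /=.
rewrite [X in _ + X](_ : _ = 0) ?addr0.
  apply: eq_bigl => w; rewrite -andbA; congr andb.
  apply/andP/idP => [[]//|h]; split=> //; apply/QP=> a c at_ ac.
  by apply: (QP _ _ h) => //; apply: ltnW.
have tL : (t < L)%N by lia.
have t1L : (t.+1 < L)%N by lia.
pose a := Ordinal tL; pose c := Ordinal t1L.
have ac : a != c by rewrite -val_eqE /= neq_ltn ltnSn.
have fb (w : 'X_{1..L < b}) : (mdeg (w#(tperm a c)) < b)%N.
  by rewrite mdeg_mperm bmdeg.
pose f (w : 'X_{1..L < b}) := BMultinom (fb w).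
have fK : involutive f.
  move=> w; apply/val_inj => /=; apply/mnmP=> i; rewrite !mnmE.
  by congr (bmnm w _); apply: tpermK.
pose P (w : 'X_{1..L < b}) := [&& (w <= u)%MM, Q t w & ~~ Q t.+1 w].
have Pf (w : 'X_{1..L < b}) : P w -> P (f w).
  move=> /and3P[/mnm_lepP wu /QP hQ nQ].
  (* [u c] is the largest entry of [u] after place t, so a violation at t already occurs against it;
     this also keeps the exchanged exponent below [u]. *)
  have wa : (w a <= u c)%N.
    rewrite leqNgt; apply: contra nQ => uw; apply/QP => i j.
    rewrite ltnS leq_eqVlt => /orP[/eqP it|]; last exact: hQ.
    rewrite it => tj; have -> : i = a by exact: val_inj.
    apply: leq_ltn_trans uw; rewrite leq_eqVlt; case: (ltngtP c j) => [/su ->||/val_inj ->].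
    - by rewrite orbT.
    - by rewrite /= ltnNge tj.
    - by rewrite eqxx.
  apply/and3P; split.
  - apply/mnm_lepP=> i; rewrite mnmE; case: tpermP => [->|->|_ _]; last exact: wu.
      apply: leq_trans (wu c) _; apply/ltnW/su; exact: ltnSn.
    by [].
  - apply/QP=> i j it ij; rewrite mnmE tpermD; first exact: hQ.
      by rewrite -val_eqE /= neq_ltn it orbT.
    by rewrite -val_eqE /= neq_ltn (ltn_trans it) ?orbT.
  apply/negP=> /QP/(_ a c (ltnSn _) (ltnSn _)).
  by rewrite mnmE tpermL ltnNge wu.
set S := (X in X = 0).
have SP : S = \sum_(w | P w) F w by apply: eq_bigl => w; rewrite /P andbA.
suff : S = - S.
  by move/eqP; rewrite -addr_eq0 -mulr2n mulrn_eq0 /= => /eqP.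
rewrite {1}SP (reindex_inj (inv_inj fK)) SP -sumrN.
apply: eq_big => [w|w _].
  apply/idP/idP; last exact: Pf.
  by move/Pf; rewrite fK.
by rewrite /= hF odd_tperm ac expr1 mulN1r.
Qed.

(** The product sums p over all exponents below u of the right degree. Antisymmetry of p cancels
    those that do not interlace; k <= n ensures that [hsym k] contains every monomial of degree
    k. *)
Lemma pieri p u k : antisymmetric_poly p -> strict u -> (k <= n)%N ->
  (p * hsym k)@_u =
  \sum_(w : 'X_{1..L < (mdeg u).+1} | interlace u w && (mdeg w + k == mdeg u)%N)
     p@_w.
Proof.
move=> hp su kn; rewrite mcoeffM_sub big_mkcondr /=.
rewrite -(@antisym_sum_interlace
  (fun w => if (mdeg w + k == mdeg u)%N then p@_w else 0)) //.
  apply: eq_bigr => w wu; rewrite mcoeff_hsym //.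
  have := mdegD (u - w)%MM w; rewrite submK // => E.
  have -> : (mdeg w + k == mdeg u)%N = (mdeg (u - w)%MM == k) by lia.
  by case: eqP; rewrite ?mulr1 ?mulr0.
by move=> s m; rewrite mdeg_mperm hp; case: ifP; rewrite ?mulr0.
Qed.

Lemma antisym_mul_hsym p k : antisymmetric_poly p -> (k <= n)%N ->
  antisymmetric_poly (p * hsym k).
Proof.
move=> hp kn s m.
have E q : (forall m, q@_(m#s) = (-1) ^+ s * q@_m) <-> msym s q = (-1) ^+ s *: q.
  split=> [h|h m']; first by apply/mpolyP=> m'; rewrite mcoeff_sym mcoeffZ h.
  by rewrite -mcoeff_sym h mcoeffZ.
move: m; apply/E; rewrite msymM (E p).1 // -scalerAl; congr (_ *: (_ * _)).
by apply/mpolyP=> m; rewrite mcoeff_sym !mcoeff_hsym // mdeg_mperm.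
Qed.
End Alternants.

(** * Dominance and unitriangularity of the Kostka coefficients *)

Section Triangularity.
Variables (R : numFieldType) (n : nat).
Local Notation L := n.+1.
Local Notation "m # s" := [multinom m (s i) | i < L]
  (at level 40, left associativity, format "m # s").
Implicit Types (u v w m nu la : 'X_{1..L}) (s : 'S_L).
Local Notation delta := (delta n).
Local Notation hsym := (@hsym R n).

Definition psum u t := (\sum_(i : 'I_L | i < t) u i)%N.

Definition hprod nu j : {mpoly R[L]} :=
  alternant R delta * \prod_(c : 'I_L | (c < j)%N) hsym (nu c).

Lemma psumS u j (jL : (j < L)%N) : psum u j.+1 = (psum u j + u (Ordinal jL))%N.
Proof.
rewrite /psum (bigD1 (Ordinal jL)) //= addnC; congr (_ + _)%N.
apply: eq_bigl => i; rewrite ltnS -val_eqE /= ltn_neqAle andbC //.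
Qed.

Lemma psum_tail u v j : (forall i : 'I_L, (j <= i)%N -> u i = v i) ->
  (mdeg u + psum v j = mdeg v + psum u j)%N.
Proof.
move=> h; rewrite !mdegE (bigID (fun i : 'I_L => (i < j)%N)) /=.
rewrite [in RHS](bigID (fun i : 'I_L => (i < j)%N)) /= -/(psum u j) -/(psum v j).
rewrite (eq_bigr (fun i => v i)) => [|i]; last by rewrite -leqNgt => /h.
lia.
Qed.

Lemma psum_eq u v j : (forall i : 'I_L, (i < j)%N -> u i <= v i)%N ->
  (psum v j <= psum u j)%N -> forall i : 'I_L, (i < j)%N -> u i = v i.
Proof.
move=> h hp i ij; apply/eqP; rewrite eqn_leq h //=.
have : (\sum_(k : 'I_L | (k < j) && (k != i)) u k <=
        \sum_(k : 'I_L | (k < j) && (k != i)) v k)%N.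
  by apply: leq_sum => k /andP[/h].
move: hp; rewrite /psum (bigD1 i) //= [X in (_ <= X)%N](bigD1 i) //=.
by move: (\sum_(k | _) u k)%N (\sum_(k | _) v k)%N => A B; lia.
Qed.

Lemma hprodS nu j (jL : (j < L)%N) :
  hprod nu j.+1 = hprod nu j * hsym (nu (Ordinal jL)).
Proof.
rewrite /hprod (bigD1 (Ordinal jL)) //= -mulrA; congr (_ * _).
rewrite mulrC; congr (_ * _).
by apply: eq_bigl => i; rewrite ltnS -val_eqE /= ltn_neqAle andbC.
Qed.

Lemma hprod0 nu : hprod nu 0 = alternant R delta.
Proof. by rewrite /hprod big_pred0 ?mulr1 // => i; rewrite ltn0. Qed.

Lemma antisym_hprod nu j : (forall c, nu c <= n)%N -> (j <= L)%N ->
  antisymmetric_poly (hprod nu j).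
Proof.
move=> hnu; elim: j => [|j IH] jL; first by rewrite hprod0; apply: antisym_alternant.
by rewrite (hprodS _ jL); apply: antisym_mul_hsym => //; apply: IH; apply: ltnW.
Qed.

(** By Pieri each factor adds a horizontal strip, which enters at most one new row. So the first t
    factors fill only the first t rows, and later factors can only lengthen these. *)
Lemma kostka_dominance nu j u : (forall c, nu c <= n)%N -> (j <= L)%N ->
    strict u -> (hprod nu j)@_u != 0 ->
  [/\ forall t, (t <= j)%N -> (psum nu t + psum delta t <= psum u t)%N,
      forall i : 'I_L, (j <= i)%N -> u i = delta i &
      mdeg u = (mdeg delta + psum nu j)%N].
Proof.
move=> hnu; elim: j u => [|j IH] u jL su.
  rewrite hprod0 alternant_strict //; last exact: delta_strict.
  have [<- _|_] := eqVneq delta u; last by rewrite eqxx.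
  split=> //; last by rewrite /psum big_pred0 ?addn0.
  by move=> t; rewrite leqn0 => /eqP ->; rewrite /psum !big_pred0.
rewrite (hprodS _ jL) pieri //; last exact: antisym_hprod (ltnW jL).
set k := nu (Ordinal jL) => hn0.
have [w /andP[/andP[hi /eqP hd] hw]|h0] := pickP (fun w : 'X_{1..L < (mdeg u).+1} =>
  interlace u w && (mdeg w + k == mdeg u)%N && ((hprod nu j)@_w != 0)); last first.
  move: hn0; rewrite big1 ?eqxx // => w hw.
  by have := h0 w; rewrite hw /= => /negbFE/eqP.
have [IH1 IH2 IH3] := IH _ (ltnW jL) (interlace_strict hi) hw.
have /interlaceP[wu uw] := hi.
(* Row i - 1 of [w] is still empty, and interlacing bounds [u i] strictly by [w (i - 1)], hence by
   [delta i]. *)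
have tail (i : 'I_L) : (j < i)%N -> u i = delta i.
  move=> ji; apply/eqP; rewrite eqn_leq strict_ge_delta // andbT.
  have i1 : (i.-1 < L)%N by have := ltn_ord i; lia.
  have := @uw (Ordinal i1) i; rewrite (IH2 (Ordinal i1)) /= ?deltaE /=; last by lia.
  by have := ltn_ord i; lia.
have deg : mdeg u = (mdeg delta + psum nu j.+1)%N.
  by rewrite (psumS _ jL) -/k; lia.
split=> // t; rewrite leq_eqVlt => /orP[/eqP ->|].
  by have := psum_tail tail; lia.
rewrite ltnS => tj; apply: leq_trans (IH1 t tj) _.
by apply: leq_sum => i _; apply: wu.
Qed.

Definition trunc la j : 'X_{1..L} :=
  [multinom (delta i + (if (i < j)%N then la i else 0))%N | i < L].

Lemma truncE la j i : trunc la j i = (n - i + (if (i < j)%N then la i else 0))%N.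
Proof. by rewrite mnmE deltaE. Qed.

Lemma mdeg_trunc la j : mdeg (trunc la j) = (mdeg delta + psum la j)%N.
Proof.
rewrite !mdegE /psum [X in (_ + X)%N]big_mkcond /= -big_split /=.
by apply: eq_bigr => i _; rewrite mnmE.
Qed.

Lemma trunc_strict la j : (forall i k : 'I_L, (i <= k)%N -> la k <= la i)%N ->
  strict (trunc la j).
Proof.
move=> hla i k ik; rewrite !truncE; have := hla _ _ (ltnW ik).
have := ltn_ord k; case: ifP => h1; case: ifP => h2; lia.
Qed.

(** Only one chain of horizontal strips ends at this shape, the one adding row c at step c: a
    contributing w lies below the truncated shape in the first j rows, and dominance makes it at
    least as large there. *)
Lemma kostka_one la j : (forall c, la c <= n)%N ->
    (forall i k : 'I_L, (i <= k)%N -> la k <= la i)%N -> (j <= L)%N ->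
  (hprod la j)@_(trunc la j) = 1.
Proof.
move=> hn hla; elim: j => [|j IH] jL.
  rewrite hprod0 alternant_strict; [|exact: trunc_strict|exact: delta_strict].
  have -> // : delta = trunc la 0; last by rewrite eqxx.
  by apply/mnmP=> i; rewrite truncE deltaE ltn0 addn0.
set u := trunc la j.+1.
have su : strict u by exact: trunc_strict.
rewrite (hprodS _ jL) pieri //; last exact: antisym_hprod (ltnW jL).
have du : mdeg u = (mdeg (trunc la j) + la (Ordinal jL))%N.
  by rewrite !mdeg_trunc (psumS _ jL) addnA.
have hb : (mdeg (trunc la j) < (mdeg u).+1)%N by rewrite du ltnS leq_addr.
have hi : interlace u (trunc la j).
  apply/interlaceP; split=> [i|a b ab].
    by rewrite !truncE leq_add2l; case: (ltnP i j) => // ij; rewrite ltnS (ltnW ij).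
  rewrite !truncE; have := hla _ _ (ltnW ab); have := ltn_ord b.
  by case: ifP => h1; case: ifP => h2; lia.
rewrite (bigD1 (BMultinom hb)) /=; last by rewrite hi du eqxx.
rewrite IH ?(ltnW jL) // big1 ?addr0 // => w /andP[/andP[hw _] wn].
apply/eqP; apply: contraNT wn => hne.
have [d1 d2 _] := kostka_dominance hn (ltnW jL) (interlace_strict hw) hne.
have /interlaceP[wu _] := hw.
apply/eqP/val_inj/mnmP => /= i.
have pt t : (t <= j)%N -> psum (trunc la j) t = (psum la t + psum delta t)%N.
  move=> tj; rewrite /psum -big_split /=; apply: eq_bigr => k kt.
  by rewrite mnmE (leq_trans kt tj) addnC.
have [ji|ij] := leqP j i.
  by rewrite (d2 i ji) truncE ltnNge ji addn0 deltaE.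
apply: (@psum_eq w (trunc la j) j) => // [k kj|]; last by rewrite pt // d1.
by have := wu k; rewrite !truncE kj ltnS (ltnW kj).
Qed.

(** Dominance says that the first t entries of [delta#s] sum to at least those of [delta]. Since
    [delta] is strictly decreasing, this fixes the places 0, 1, ... successively. *)
Lemma perm_dominated s la :
    (delta#s <= delta + la)%MM ->
    (forall t, t <= L -> psum (delta + la - delta#s)%MM t <= psum la t)%N ->
  s = 1%g.
Proof.
move=> hs h.
have h2 t : (t <= L -> psum delta t <= psum (delta#s) t)%N.
  move=> tL; have := h t tL.
  have : (psum (delta + la - delta#s)%MM t + psum (delta#s) t
          = psum delta t + psum la t)%N.
    rewrite /psum -!big_split /=; apply: eq_bigr => i _.
    have /mnm_lepP/(_ i) := hs; rewrite mnmBE mnmDE => hi.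
    by rewrite subnK.
  lia.
have fixs (m : nat) (i : 'I_L) : (i < m)%N -> s i = i.
  elim: m i => // m IH i; rewrite ltnS leq_eqVlt => /orP[/eqP im|]; last exact: IH.
  have mL : (m < L)%N by rewrite -im.
  have im' : i = Ordinal mL by exact: val_inj.
  have := h2 m.+1 mL; rewrite !(psumS _ mL) -im' mnmE.
  have -> : psum (delta#s) m = psum delta m.
    by apply: eq_bigr => k km; rewrite mnmE IH.
  rewrite leq_add2l !deltaE => hle.
  have [sim|] := ltnP (s i) m.
    by have /perm_inj := IH _ sim.
  move=> msi; apply/val_inj/eqP; rewrite eqn_leq /= im msi andbT.
  by have := ltn_ord (s i); lia.
by apply/permP=> i; rewrite perm1 (fixs L).
Qed.

Lemma trunc_full la : trunc la L = (delta + la)%MM.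
Proof. by apply/mnmP=> i; rewrite mnmE ltn_ord mnmDE. Qed.

Lemma hprod_full nu : hprod nu L = alternant R delta * \prod_c hsym (nu c).
Proof. by congr (_ * _); apply: eq_bigl => i; rewrite ltn_ord. Qed.

Lemma mnm_le_mdeg m i : (m i <= mdeg m)%N.
Proof. by rewrite mdegE (bigD1 i) //= leq_addr. Qed.

Section Shape.
Variable la : 'X_{1..L}.
Hypothesis hla : forall i k : 'I_L, (i <= k)%N -> (la k <= la i)%N.
Hypothesis dla : mdeg la = n.

Lemma strict_shift : strict (delta + la)%MM.
Proof. by rewrite -trunc_full; apply: trunc_strict. Qed.

Lemma kostka_diag : (alternant R delta * \prod_c hsym (la c))@_(delta + la) = 1.
Proof.
rewrite -hprod_full -trunc_full kostka_one // => c.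
by apply: leq_trans (mnm_le_mdeg la c) _; rewrite dla.
Qed.

(** Such exponents arise when the alternant of [delta] is expanded over permutations, as in
    [frobenius_pairing]. A nonzero coefficient would make la dominate them, which forces s = 1. *)
Lemma kostka_off s : s != 1%g -> (delta#s <= delta + la)%MM ->
  (alternant R delta * \prod_c hsym ((delta + la - delta#s)%MM c))@_(delta + la) = 0.
Proof.
move=> s1 hs; rewrite -hprod_full; apply/eqP; apply: contraNT s1 => hne.
set nu := (delta + la - delta#s)%MM in hne.
have dnu : mdeg nu = n.
  have := mdegD nu (delta#s); rewrite submK // mdeg_mperm mdegD dla; lia.
have hnu c : (nu c <= n)%N by apply: leq_trans (mnm_le_mdeg nu c) _; rewrite dnu.
have [h _ _] := kostka_dominance hnu (leqnn _) strict_shift hne.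
apply/eqP/(perm_dominated hs) => t /h; rewrite -/nu.
have -> : psum (delta + la)%MM t = (psum delta t + psum la t)%N.
  by rewrite /psum -big_split; apply: eq_bigr => i _; rewrite mnmDE.
lia.
Qed.
End Shape.
End Triangularity.

(** * Products of two complete symmetric polynomials *)

Section Rules.
Variables (R : numFieldType) (n : nat).
Local Notation L := n.+1.
Local Notation "m # s" := [multinom m (s i) | i < L]
  (at level 40, left associativity, format "m # s").
Implicit Types (u v w m nu la : 'X_{1..L}) (s : 'S_L).
Local Notation delta := (delta n).
Local Notation hsym := (@hsym R n).
Local Notation alternant := (alternant R).

(** At an exponent with a repeated entry the coefficient equals its opposite and vanishes; any other
    exponent is sorted, up to a sign, into a strictly decreasing one. *)
Lemma antisym_ext (p q : {mpoly R[L]}) :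
    antisymmetric_poly p -> antisymmetric_poly q ->
  (forall u, strict u -> p@_u = q@_u) -> p = q.
Proof.
move=> hp hq h; apply/mpolyP=> m.
have [/injectiveP inj|/injectivePn[i [j ij mij]]] := boolP (injectiveb m); last first.
  have z (r : {mpoly R[L]}) : antisymmetric_poly r -> r@_m = 0.
    move=> hr; have := hr (tperm i j) m.
    have -> : m#(tperm i j) = m.
      by apply/mnmP=> k; rewrite mnmE; case: tpermP => // ->.
    rewrite odd_tperm ij expr1 mulN1r => /eqP.
    by rewrite -addr_eq0 -mulr2n mulrn_eq0 /= => /eqP.
  by rewrite !z.
pose t := [tuple m i | i < L].
have ps : perm_eq (sort geq t) t by rewrite perm_sort.
have /tuple_permP[s hs] := ps.
have su : strict (m#s).
  move=> i j ij; rewrite !mnmE ltn_neqAle (inj_eq inj) (inj_eq perm_inj).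
  rewrite -val_eqE neq_ltn ij orbT /=.
  have so : sorted geq (sort geq t) by apply: sort_sorted => a b; apply: leq_total.
  have E k : nth 0%N (sort geq t) (k : 'I_L) = m (s k).
    by rewrite hs -tnth_nth !tnth_mktuple.
  rewrite -!E; apply: (@sorted_leq_nth _ geq _ _ 0%N _ so) => //.
  - by move=> a b c /= h1 h2; apply: leq_trans h2 h1.
  - by move=> a /=.
  - by rewrite inE size_sort size_tuple.
  - by rewrite inE size_sort size_tuple.
  exact: ltnW.
have := h _ su; rewrite hp hq; apply: mulfI; by rewrite signr_eq0.
Qed.

Lemma antisymD (p q : {mpoly R[L]}) :
  antisymmetric_poly p -> antisymmetric_poly q -> antisymmetric_poly (p + q).
Proof. by move=> hp hq s m; rewrite !mcoeffD hp hq mulrDr. Qed.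

Lemma antisymZ (c : R) (p : {mpoly R[L]}) :
  antisymmetric_poly p -> antisymmetric_poly (c *: p).
Proof. by move=> hp s m; rewrite !mcoeffZ hp mulrCA. Qed.

Lemma antisym_sum (I : finType) (P : pred I) (F : I -> {mpoly R[L]}) :
  (forall i, P i -> antisymmetric_poly (F i)) ->
  antisymmetric_poly (\sum_(i | P i) F i).
Proof.
move=> h; apply: big_ind => //; last exact: antisymD.
by move=> s m; rewrite !mcoeff0 mulr0.
Qed.

Definition rows2 a b : 'X_{1..L} := [multinom nth 0%N [:: a; b] i | i < L].

Lemma rows2_decr a b : (b <= a)%N ->
  forall i k : 'I_L, (i <= k)%N -> (rows2 a b k <= rows2 a b i)%N.
Proof.
move=> ba i k; rewrite !mnmE.
case: (nat_of_ord i) => [|[|i']]; case: (nat_of_ord k) => [|[|k']] //=;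
  by rewrite ?nth_nil.
Qed.

Hypothesis n0 : (0 < n)%N.
Let i0 : 'I_L := ord0.
Let i1 : 'I_L := Ordinal (n0 : (1 < n.+1)%N).

Lemma sum_rows (f : 'I_L -> nat) :
  (\sum_i f i = f i0 + f i1 + \sum_(i : 'I_L | 1 < i) f i)%N.
Proof.
rewrite (bigD1 i0) //= (bigD1 i1) //= addnA; congr (_ + _)%N.
apply: eq_bigl => i; rewrite -!val_eqE /=; lia.
Qed.

Lemma mdeg_rows2 a b : mdeg (rows2 a b) = (a + b)%N.
Proof.
rewrite mdegE sum_rows !mnmE /= big1 ?addn0 // => i.
by rewrite mnmE; case: (nat_of_ord i) => [|[|k]] //=; rewrite nth_nil.
Qed.

Lemma rows2_shift a b i : (delta + rows2 a b)%MM i =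
  (n - i + (if i == i0 then a else if i == i1 then b else 0))%N.
Proof.
rewrite mnmDE deltaE mnmE; congr addn; rewrite -!val_eqE /=.
by case: (nat_of_ord i) => [|[|k]] //=; rewrite nth_nil.
Qed.

(** A single factor can fill only the first row, and the degree then determines its length. *)
Lemma alternant_hsym a w : (a <= n)%N -> strict w ->
  (alternant delta * hsym a)@_w = (w == delta + rows2 a 0)%MM%:R.
Proof.
move=> an sw.
have hn c : (rows2 a 0 c <= n)%N.
  by rewrite mnmE; case: (nat_of_ord c) => [|[|k]] //=; rewrite nth_nil.
have E : hprod R (rows2 a 0) 1 = alternant delta * hsym a.
  by rewrite (hprodS _ _ (ltn0Sn n)) hprod0 mnmE.
have T : trunc (rows2 a 0) 1 = (delta + rows2 a 0)%MM.
  apply/mnmP=> i; rewrite truncE mnmDE deltaE mnmE.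
  by case: (nat_of_ord i) => [|[|k]] //=; rewrite nth_nil.
have [->|wn] := eqVneq.
  by rewrite -E -T kostka_one //; apply: rows2_decr.
apply/eqP; apply: contraNT wn; rewrite -E => hne.
have [h1 h2 h3] := kostka_dominance hn (ltn0Sn n) sw hne.
have tl (i : 'I_L) : (1 <= i)%N -> w i = (delta + rows2 a 0)%MM i.
  by move=> hi; rewrite h2 // -T truncE ltnNge hi addn0 deltaE.
apply/eqP/mnmP=> i; have [/tl//|] := leqP 1 i.
rewrite ltnS leqn0 => /eqP i00; have -> : i = i0 by exact: val_inj.
have := psum_tail tl; rewrite -T mdeg_trunc T h3 => /addnI.
by rewrite !(psumS _ (ltn0Sn n)) /psum !big_pred0 // !add0n.
Qed.

Lemma sum_indicator (b : nat) (P : pred 'X_{1..L}) v :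
  (P v -> mdeg v < b)%N ->
  \sum_(w : 'X_{1..L < b} | P w) ((w : 'X_{1..L}) == v)%:R = (P v)%:R :> R.
Proof.
move=> hb; have [Pv|nPv] := boolP (P v).
  rewrite (bigD1 (BMultinom (hb Pv))) //= eqxx big1 ?addr0 // => w /andP[_ wn].
  by case: eqP => // wv; case/eqP: wn; apply/val_inj.
by rewrite big1 // => w Pw; case: eqP => // wv; move: nPv; rewrite -wv Pw.
Qed.

Lemma count_interval N lo hi : (hi <= N)%N ->
  (\sum_(a < N) ((lo <= a) && (a < hi)) = hi - lo)%N.
Proof.
move=> hN; have -> : (hi - lo = minn hi N - lo)%N by rewrite (minn_idPl hN).
elim: N {hN} => [|N IH]; first by rewrite big_ord0 minn0 sub0n.
by rewrite big_ord_recr /= IH; lia.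
Qed.

Lemma interlace_row u a : strict u ->
  interlace u (delta + rows2 a 0)%MM =
  [&& (n + a <= u i0)%N, (u i1 < n + a)%N & [forall i : 'I_L, (1 < i)%N ==> (u i == delta i)]].
Proof.
move=> su; apply/interlaceP/and3P.
  move=> [h1 h2]; split.
  - by have := h1 i0; rewrite rows2_shift subn0.
  - by have := h2 i0 i1 (ltn0Sn 0); rewrite rows2_shift subn0.
  apply/forallP=> i; apply/implyP=> hi; rewrite eqn_leq strict_ge_delta // andbT deltaE.
  have kL : (i.-1 < L)%N by have := ltn_ord i; lia.
  have := h2 (Ordinal kL) i; rewrite rows2_shift -!val_eqE /=.
  have -> : (i.-1 == 0)%N = false by lia.
  by rewrite if_same addn0; have := ltn_ord i; lia.
move=> [h1 h2 /forallP h3].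
have h (i : 'I_L) : (1 < i)%N -> u i = (n - i)%N.
  by move=> hi; have /implyP/(_ hi)/eqP := h3 i; rewrite deltaE.
split=> [i|c d cd].
  rewrite rows2_shift; case: eqP => [->|]; first by rewrite subn0.
  by rewrite if_same addn0 -deltaE => _; apply: strict_ge_delta.
rewrite rows2_shift if_same; case: eqP => [c0|/eqP].
  rewrite c0 subn0; apply: leq_ltn_trans h2.
  have [/h ->|] := ltnP 1 d; last first.
    move=> d1; rewrite (_ : d = i1) //; apply/val_inj => /=.
    by move: cd; rewrite c0 /=; lia.
  have := strict_ge_delta su i1; rewrite deltaE /=; lia.
rewrite -val_eqE /= => c0; rewrite addn0 h; last lia.
by have := ltn_ord d; lia.
Qed.

(** By Pieri the product h_a h_(m-a) contributes 1 exactly when u 1 - (n - 1) <= a <= u 0 - n. For u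
    = delta + [A, B] this is B <= a <= A, and the length A - B + 1 of this interval is u 0 - u 1. *)
Lemma alternant_two_rows (m : nat) u : (m <= n)%N -> strict u ->
  (alternant delta * \sum_(a < m.+1) hsym a * hsym (m - a)%N)@_u =
  ([forall i : 'I_L, (1 < i)%N ==> (u i == delta i)] &&
   (mdeg u == mdeg delta + m)%N)%:R * (u i0 - u i1)%N%:R.
Proof.
move=> mn su; rewrite mulr_sumr raddf_sum /=.
set Z := [forall _, _]; set D := (_ == _).
have T (a : 'I_m.+1) : (alternant delta * (hsym a * hsym (m - a)%N))@_u =
    ((u i1 + 1 - n <= a) && (a < u i0 + 1 - n))%N%:R * (Z && D)%:R.
  have an : (a <= n)%N by have := ltn_ord a; lia.
  rewrite mulrA pieri //; last 2 first.
  - by apply: antisym_mul_hsym => //; apply: antisym_alternant.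
  - by lia.
  rewrite (eq_bigr (fun w : 'X_{1..L < (mdeg u).+1} =>
      ((w : 'X_{1..L}) == delta + rows2 a 0)%MM%:R)); last first.
    by move=> w /andP[/interlace_strict sw _]; apply: alternant_hsym.
  rewrite (sum_indicator (P := fun w => interlace u w && (mdeg w + (m - a) == mdeg u)%N));
    last by move=> /andP[_ /eqP <-]; rewrite ltnS leq_addr.
  rewrite interlace_row // -/Z mdegD mdeg_rows2 addn0 -addnA subnKC; last first.
    by have := ltn_ord a; lia.
  rewrite [(_ == mdeg u)]eq_sym -/D -natrM mulnb; congr (nat_of_bool _)%:R.
  have := strict_ge_delta su i1; have := su i0 i1 (ltn0Sn 0); rewrite deltaE /=.
  by case: Z; case: D; rewrite ?andbT ?andbF //; lia.
rewrite (eq_bigr _ (fun a _ => T a)) -mulr_suml mulrC.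
have [/andP[_ /eqP hD]|] := boolP (Z && D); last by rewrite !mul0r.
rewrite !mul1r -natr_sum count_interval.
  congr (_%:R); have := strict_ge_delta su i1; rewrite deltaE /=.
  by have := su i0 i1 (ltn0Sn 0); lia.
have : (u i0 <= delta i0 + m)%N.
  have h : (\sum_(i | i != i0) delta i <= \sum_(i | i != i0) u i)%N.
    by apply: leq_sum => i _; apply: strict_ge_delta.
  have D1 v : mdeg v = (v i0 + \sum_(i | i != i0) v i)%N by rewrite mdegE (bigD1 i0).
  by move: hD h; rewrite !D1; move: (\sum_(i | _) delta i)%N => A; lia.
by rewrite deltaE subn0; lia.
Qed.

Lemma two_row_expansion (m : nat) : (m <= n)%N ->
  alternant delta * \sum_(a < m.+1) hsym a * hsym (m - a)%N =
  \sum_(ab : 'I_L * 'I_L | (ab.2 <= ab.1)%N && (ab.1 + ab.2 == m)%N)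
    (ab.1 - ab.2 + 1)%N%:R *: alternant (delta + rows2 ab.1 ab.2)%MM.
Proof.
move=> mn; apply: antisym_ext.
- rewrite mulr_sumr; apply: antisym_sum => a _; rewrite mulrA.
  apply: antisym_mul_hsym; last by lia.
  apply: antisym_mul_hsym; last by have := ltn_ord a; lia.
  exact: antisym_alternant.
- by apply: antisym_sum => ab _; apply: antisymZ; apply: antisym_alternant.
move=> u su; rewrite alternant_two_rows // raddf_sum /=.
rewrite (eq_bigr (fun ab : 'I_L * 'I_L => (ab.1 - ab.2 + 1)%N%:R *
    ((delta + rows2 ab.1 ab.2)%MM == u)%:R)); last first.
  move=> ab /andP[h _]; rewrite mcoeffZ alternant_strict //.
  by apply: strict_shift; apply: rows2_decr.
have E1 := strict_ge_delta su i1; have E0 := su i0 i1 (ltn0Sn 0).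
rewrite deltaE /= in E1.
have [/andP[/forallP hZ /eqP hD]|] := boolP (_ && _); last first.
  move=> hZD; rewrite mul0r big1 // => -[a b] /= /andP[ba /eqP abm].
  case: eqP => [hu|]; rewrite ?mulr0 //; case/negP: hZD; apply/andP; split.
    apply/forallP=> i; apply/implyP=> hi; rewrite -hu rows2_shift deltaE -!val_eqE /=.
    by case: (nat_of_ord i) hi => [|[|k]] //= _; rewrite addn0.
  by rewrite -hu mdegD mdeg_rows2 abm.
have hm : (u i0 + u i1 = n + (n - 1) + m)%N.
  move: hD; rewrite !mdegE !sum_rows !deltaE /=.
  rewrite (eq_bigr delta) => [|i hi]; last by have /implyP/(_ hi)/eqP := hZ i.
  by lia.
(* The only contributing pair is read off u by removing [delta]; u 1 + 1 - n stands for u 1 - (n -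
   1). *)
have aL : (u i0 - n < L)%N by lia.
have bL : (u i1 + 1 - n < L)%N by lia.
rewrite mul1r (bigD1 (Ordinal aL, Ordinal bL)) /=; last by apply/andP; split; lia.
have -> : (delta + rows2 (u i0 - n) (u i1 + 1 - n))%MM = u.
  apply/mnmP=> i; rewrite rows2_shift; case: eqP => [->|/eqP hi0].
    by rewrite /=; lia.
  case: eqP => [->|/eqP hi1]; first by rewrite /=; lia.
  have hi : (1 < i)%N by move: hi0 hi1; rewrite -!val_eqE /=; lia.
  by have /implyP/(_ hi)/eqP := hZ i; rewrite deltaE addn0.
rewrite eqxx mulr1 big1 ?addr0; first by congr (_%:R); lia.
move=> -[a b] /= /andP[/andP[ba /eqP abm] abn].
case: eqP => [hu|]; rewrite ?mulr0 //; case/negP: abn; apply/eqP.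
by congr pair; apply/val_inj => /=; rewrite -hu rows2_shift /=; lia.
Qed.

End Rules.

(** * The Murnaghan-Nakayama rule on strictly decreasing exponents *)

Section MurnaghanNakayama.
Variables (R : numFieldType) (n : nat).
Local Notation L := n.+1.
Local Notation "m # s" := [multinom m (s i) | i < L]
  (at level 40, left associativity, format "m # s").
Implicit Types (u v : 'X_{1..L}) (s : 'S_L).
Local Notation alternant := (alternant R).

(* In terms of the shifted shapes [u] and [v]: a border strip of [k] boxes
   occupying the rows [t], ..., [j]. *)
Definition rim u v k (t j : 'I_L) :=
  [/\ (t <= j)%N, forall i : 'I_L, (i < t)%N -> v i = u i,
      forall i i' : 'I_L, i' = i.+1 :> nat -> (t <= i < j)%N -> v i = u i',
      (v j + k)%N = u t & forall i : 'I_L, (j < i)%N -> v i = u i].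

Lemma lift_val k (t : 'I_k.+1) (c : 'I_k) :
  lift t c = (if (c < t)%N then c : nat else c.+1) :> nat.
Proof. by rewrite /= /bump leqNgt; case: ltnP. Qed.

(** After k is subtracted from entry t of u, sorting moves this entry to place j and shifts those
    between by one. The cycle doing so is [lift_perm t j 1], of sign (-1)^(t + j). *)
Lemma alternant_rim u v k t j : strict v -> rim u v k t j ->
  (alternant v)@_(u - U_(t) *+ k)%MM = (-1) ^+ (t + j).
Proof.
move=> sv [tj h1 h2 h3 h4]; rewrite mcoeff_alternant.
have E : v#(lift_perm t j 1%g) = (u - U_(t) *+ k)%MM.
  apply/mnmP=> i; rewrite mnmE mnmBE mulmnE mnm1E.
  case: (unliftP t i) => [c ->|->]; last by rewrite lift_perm_id eqxx; lia.
  rewrite lift_perm_lift perm1 (negbTE (neq_lift _ _)) mul0n subn0.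
  have [ct|tc] := ltnP c t.
    have -> : lift j c = lift t c.
      by apply/ord_inj; rewrite !lift_val ct (leq_trans ct tj).
    by apply: h1; rewrite lift_val ct.
  have [cj|jc] := ltnP c j.
    by apply: h2; rewrite !lift_val cj ?tc ?cj // ltnNge tc.
  have -> : lift j c = lift t c.
    by apply/ord_inj; rewrite !lift_val !ltnNge tc jc.
  by apply: h4; rewrite lift_val [(c < t)%N]ltnNge tc /= ltnS.
rewrite (bigD1 (lift_perm t j 1%g)) //= E eqxx mulr1 big1 ?addr0.
  by rewrite odd_lift_perm odd_perm1 addbF -oddD signr_odd.
move=> s sn; case: eqP => [|]; rewrite ?mulr0 // -E => hs.
case/eqP: sn; apply/permP=> i; apply: (strict_inj sv).
by have /mnmP/(_ i) := hs; rewrite !mnmE.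
Qed.

(** A nonzero coefficient provides a permutation s sorting u with k removed from entry t. With j = s
    t, deleting t from the source and j from the target leaves an increasing map, hence the
    identity, so s moves only the entry t past the others. *)
Lemma rim_of_alternant u v k t : strict u -> strict v -> (0 < k <= u t)%N ->
  (alternant v)@_(u - U_(t) *+ k)%MM != 0 -> exists j, rim u v k t j.
Proof.
move=> su sv /andP[k0 kt]; rewrite mcoeff_alternant => hne.
have [s /eqP hs|h0] := pickP [pred s : 'S_L | v#s == (u - U_(t) *+ k)%MM]; last first.
  move: hne; rewrite big1 ?eqxx // => s _.
  by have /= -> := h0 s; rewrite mulr0.
have E i : v (s i) = (u i - (t == i) * k)%N.
  by have /mnmP/(_ i) := hs; rewrite mnmE mnmBE mulmnE mnm1E.
set j := s t; exists j.
have Et : (v j + k)%N = u t by rewrite /j E eqxx; lia.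
have El (c : 'I_n) : s (lift t c) != j.
  by rewrite (inj_eq perm_inj) eq_sym neq_lift.
(* The default of [odflt] is never taken, since s sends only t to j. *)
pose g (c : 'I_n) := odflt c (unlift j (s (lift t c))).
have gE c : s (lift t c) = lift j (g c).
  rewrite /g; case: unliftP => [d -> //|/eqP]; by rewrite (negbTE (El c)).
have lift_mono (i : 'I_L) (c d : 'I_n) : (lift i c < lift i d)%N = (c < d)%N.
  by rewrite !lift_val; case: ifP; case: ifP; lia.
have gid c : g c = c.
  apply: mono_ord_id => a b ab.
  rewrite -(lift_mono j) -!gE -(strict_mono sv) !E.
  rewrite !(negbTE (neq_lift _ _)) !mul0n !subn0 (strict_mono su) lift_mono //.
have F (c : 'I_n) : v (lift j c) = u (lift t c).
  by rewrite -{1}(gid c) -gE E (negbTE (neq_lift _ _)) subn0.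
have tj : (t <= j)%N.
  rewrite leqNgt; apply/negP => jt.
  have jn : (j < n)%N by have := ltn_ord t; lia.
  have := F (Ordinal jn).
  have -> : lift t (Ordinal jn) = j by apply/ord_inj; rewrite lift_val /= jt.
  have h1 : (j < lift j (Ordinal jn))%N by rewrite lift_val /= ltnn.
  have := sv _ _ h1; have := su _ _ jt; lia.
split=> //.
- move=> i it; have inn : (i < n)%N by have := ltn_ord t; lia.
  have := F (Ordinal inn).
  have -> : lift t (Ordinal inn) = i by apply/ord_inj; rewrite lift_val /= it.
  have -> // : lift j (Ordinal inn) = i.
  by apply/ord_inj; rewrite lift_val /= (leq_trans it tj).
- move=> i i' ii /andP[ti ij]; have inn : (i < n)%N by have := ltn_ord i'; lia.
  have := F (Ordinal inn).
  have -> : lift t (Ordinal inn) = i' by apply/ord_inj; rewrite lift_val /= ltnNge ti.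
  have -> // : lift j (Ordinal inn) = i.
  by apply/ord_inj; rewrite lift_val /= ij.
move=> i ji; have inn : (i.-1 < n)%N by have := ltn_ord i; lia.
have := F (Ordinal inn).
have -> : lift t (Ordinal inn) = i.
  by apply/ord_inj; rewrite lift_val /=; case: ltnP; lia.
have -> // : lift j (Ordinal inn) = i.
by apply/ord_inj; rewrite lift_val /=; case: ltnP; lia.
Qed.

Lemma rim_first u v k t j : (0 < k)%N -> strict u -> rim u v k t j -> (v t < u t)%N.
Proof.
move=> k0 su [tj h1 h2 h3 h4].
have [tj'|] := ltnP t j; last first.
  move=> jt; have E : t = j by apply/val_inj/eqP; rewrite eqn_leq tj jt.
  by rewrite -E in h3 *; lia.
have tL : (t.+1 < L)%N by have := ltn_ord j; lia.
by rewrite (h2 t (Ordinal tL)) ?leqnn ?tj' //; apply: su.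
Qed.

Lemma rim_top_unique u v k t j t' j' : (0 < k)%N -> strict u ->
  rim u v k t j -> rim u v k t' j' -> t = t'.
Proof.
move=> k0 su h h'; have := rim_first k0 su h; have := rim_first k0 su h'.
case: h h' => _ h _ _ _ [_ h' _ _ _].
by case: (ltngtP t t') => [/h' ->|/h ->|/val_inj //]; rewrite ltnn.
Qed.

(** The sum is the coefficient at u of the power sum p_k times [alternant v]. Only the index t can
    contribute, being the first place where u and v differ. *)
Lemma murnaghan_nakayama u v k t j : strict u -> strict v -> (0 < k)%N ->
  rim u v k t j ->
  \sum_(i | (k <= u i)%N) (alternant v)@_(u - U_(i) *+ k)%MM = (-1) ^+ (t + j).
Proof.
move=> su sv k0 h; have kt : (k <= u t)%N by case: h => _ _ _ <- _; rewrite leq_addl.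
rewrite (bigD1 t) //= (alternant_rim sv h) big1 ?addr0 // => i /andP[ki it].
apply/eqP; apply: contraNT it => hne.
have [|j' h'] := rim_of_alternant su sv _ hne; first by rewrite k0.
by rewrite (rim_top_unique k0 su h h').
Qed.

Lemma murnaghan_nakayama0 u v k : strict u -> strict v -> (0 < k)%N ->
    (forall t j, ~ rim u v k t j) ->
  \sum_(i | (k <= u i)%N) (alternant v)@_(u - U_(i) *+ k)%MM = 0.
Proof.
move=> su sv k0 h; apply: big1 => i ki; apply/eqP/negP => /negP hne.
have [|j hj] := rim_of_alternant su sv _ hne; first by rewrite k0.
exact: h hj.
Qed.
End MurnaghanNakayama.

(** * Border strips *)

Section BorderStrips.
Variables (n : nat) (la mu : seq nat).
Local Notation l := (nth 0%N la).
Local Notation m := (nth 0%N mu).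
Hypothesis hl : forall i k, (i <= k)%N -> (l k <= l i)%N.
Hypothesis hm : forall i k, (i <= k)%N -> (m k <= m i)%N.
Hypothesis ln : forall i, (l i <= n)%N.
Hypothesis mn : forall i, (m i <= n)%N.
Hypothesis l0 : forall i, (n <= i)%N -> l i = 0%N.
Hypothesis m0 : forall i, (n <= i)%N -> m i = 0%N.

Local Notation D := (diagram n la :\: diagram n mu).
Local Notation e := ([rel x y | [&& x \in D, y \in D & box_adj x y]]).

(** Row i occupies the columns from [m i] to [l i - 1], so the middle equation says that rows i and
    i + 1 share exactly one column: connectedness gives at least one, the absence of squares at most
    one. *)
Definition strip_rows t j :=
  [/\ (t <= j < n)%N, forall i, (i < t)%N -> m i = l i,
      forall i, (t <= i < j)%N -> (m i).+1 = l i.+1,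
      (m j < l j)%N & forall i, (j < i)%N -> m i = l i].

Lemma skewE (x : 'I_n * 'I_n) : (x \in D) = (m x.1 <= x.2 < l x.1)%N.
Proof. by rewrite !inE -leqNgt. Qed.

Lemma skew_row (x : 'I_n * 'I_n) : x \in D -> (m x.1 < l x.1)%N.
Proof. by rewrite skewE => /andP[]; apply: leq_ltn_trans. Qed.

Lemma sub_rows : diagram n mu \subset diagram n la -> forall i, (m i <= l i)%N.
Proof.
move=> /subsetP h i; have [ni|ni] := leqP n i; first by rewrite l0 ?m0.
rewrite leqNgt; apply/negP => hlt.
have hc : (l i < n)%N by apply: leq_trans hlt (mn i).
by have := h (Ordinal ni, Ordinal hc); rewrite !inE /= hlt ltnn => /(_ isT).
Qed.

(** The empty skew diagram passes the border strip test vacuously and is excluded by the first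
    hypothesis. The strip runs from the first to the last row where the lengths differ. *)
Lemma strip_rows_exist : (exists i, m i != l i) ->
  skew_is_border_strip n la mu -> exists t j, strip_rows t j.
Proof.
move=> hex /and3P[/sub_rows hsub hconn hsq].
have hlt i : m i != l i -> (m i < l i)%N by rewrite ltn_neqAle hsub => ->.
pose P i := m i != l i.
have Pn i : P i -> (i < n)%N.
  by move=> hP; rewrite ltnNge; apply/negP => ni; move: hP; rewrite /P l0 ?m0.
have [t ht mint] := ex_minnP (hex : exists i, P i).
have [j hj maxj] := ex_maxnP (hex : exists i, P i) (fun i hi => ltnW (Pn i hi)).
exists t, j; split.
- by rewrite mint //= Pn.
- by move=> i it; apply/eqP/negPn/negP => /mint; rewrite leqNgt it.
- move=> i /andP[ti ij].
  have jn := Pn _ hj; have i1n : (i.+1 < n)%N by apply: leq_ltn_trans jn.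
  have inn : (i < n)%N by apply: ltnW.
  have tn : (t < n)%N by apply: leq_ltn_trans inn.
  apply/eqP; rewrite eqn_leq; apply/andP; split.
    rewrite ltnNge; apply/negP => cut.
    have mt : (m t < n)%N by apply: leq_trans (hlt _ ht) (ln t).
    have mj : (m j < n)%N by apply: leq_trans (hlt _ hj) (ln j).
    pose x : 'I_n * 'I_n := (Ordinal tn, Ordinal mt).
    pose y : 'I_n * 'I_n := (Ordinal jn, Ordinal mj).
    have xD : x \in D by rewrite skewE /= leqnn hlt.
    have yD : y \in D by rewrite skewE /= leqnn hlt.
    have /forall_inP/(_ x xD)/forall_inP/(_ y yD) hxy := hconn.
    (* If rows i and i + 1 shared no column, no adjacency would cross between them, and row t would
       be cut off from row j. *)
    have hcl : closed e [pred z : 'I_n * 'I_n | (z.1 <= i)%N].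
      have key (z z' : 'I_n * 'I_n) : z \in D -> z' \in D -> box_adj z z' ->
          (z.1 <= i)%N -> (z'.1 <= i)%N.
        rewrite !skewE => /andP[a1 a2] /andP[b1 b2] adj zi.
        rewrite leqNgt; apply/negP => iz'.
        move: adj => /orP[/andP[/eqP hz _]|/andP[/eqP hz adj]].
          by move: iz'; rewrite -hz ltnNge zi.
        have E1 : z.1 = i :> nat by move: adj; lia.
        have E2 : z'.1 = i.+1 :> nat by move: adj; lia.
        by move: a1 b2; rewrite E1 E2 hz; move: cut; lia.
      move=> z z' /and3P[zD z'D adj]; rewrite !inE; apply/idP/idP; first exact: key adj.
      apply: key => //; move: adj; rewrite /box_adj [z'.1 == _]eq_sym [z'.2 == _]eq_sym.
      by rewrite ![(z'.1.+1 == _) || _]orbC ![(z'.2.+1 == _) || _]orbC.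
    have := closed_connect hcl hxy; rewrite !inE /= ti.
    by rewrite leqNgt ij.
  (* Two shared columns would give a square in rows i, i + 1 and columns [m i], [m i + 1]. *)
  rewrite leqNgt; apply/negP => sq; case/negP: hsq.
  have c1 : ((m i).+1 < n)%N by apply: leq_trans sq (ln _).
  have c0 : (m i < n)%N by apply: ltnW.
  apply/existsP; exists (Ordinal inn, Ordinal c0).
  apply/existsP; exists (Ordinal i1n, Ordinal c1); rewrite !skewE /= !eqxx /=.
  have := hl (leqnSn i); have := hm (leqnSn i); lia.
- exact: hlt.
by move=> i ji; apply/eqP/negPn/negP => /maxj; rewrite leqNgt ji.
Qed.

Lemma strip_rows_le t j : strip_rows t j -> forall i, (m i <= l i)%N.
Proof.
move=> [/andP[tj jn] h1 h2 h3 h4] i.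
have [/h1 ->//|ti] := ltnP i t; have [/h4 ->//|] := ltnP j i.
rewrite leq_eqVlt => /orP[/eqP ->|ij]; first exact: ltnW.
by have := h2 i; rewrite ti ij => /(_ isT); have := hl (leqnSn i); lia.
Qed.

Lemma strip_rows_nonempty t j i : strip_rows t j -> (m i < l i)%N = (t <= i <= j)%N.
Proof.
move=> [/andP[tj jn] h1 h2 h3 h4].
have [/h1 ->|ti] := ltnP i t; first by rewrite ltnn.
have [/h4 ->|] := ltnP j i; first by rewrite ltnn.
rewrite leq_eqVlt => /orP[/eqP ->|ij] //=.
by have := h2 i; rewrite ti ij => /(_ isT); have := hl (leqnSn i); lia.
Qed.

Lemma strip_rows_strip t j : strip_rows t j -> skew_is_border_strip n la mu.
Proof.
move=> hs; have hle := strip_rows_le hs; have hne i := strip_rows_nonempty i hs.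
case: hs => /andP[tj jn] h1 h2 h3 h4.
apply/and3P; split.
- by apply/subsetP => x; rewrite !inE => /leq_trans; apply.
- have esym : connect_sym e.
    apply: sym_connect_sym => x y /=; rewrite andbCA; congr [&& _, _ & _].
    rewrite /box_adj [y.1 == _]eq_sym [y.2 == _]eq_sym.
    by rewrite ![(y.1.+1 == _) || _]orbC ![(y.2.+1 == _) || _]orbC.
  have mj : (m j < n)%N by apply: leq_trans h3 (ln j).
  pose y0 : 'I_n * 'I_n := (Ordinal jn, Ordinal mj).
  (* Every box is joined to the leftmost box of row j by going left to the start of its row,
     stepping down into the shared column, and repeating; d counts the rows still to descend. *)
  suff H d (x : 'I_n * 'I_n) : x \in D -> (x.1 + d = j)%N -> connect e x y0.
    have H' x : x \in D -> connect e x y0.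
      move=> xD; apply: (H (j - x.1)%N) => //.
      have := skew_row xD.
      by rewrite hne => /andP[_ ?]; rewrite subnKC.
    apply/forall_inP=> x xD; apply/forall_inP=> y yD.
    by apply: connect_trans (H' x xD) _; rewrite esym; apply: H'.
  have left (y x' : 'I_n * 'I_n) : y \in D -> x'.1 = y.1 -> x'.2 = m y.1 :> nat ->
      connect e y x'.
    move=> yD e1 e2; move hc : (y.2 - m y.1)%N => c.
    elim: c y yD e1 e2 hc => [|c IH] {}x xD e1 e2 hc.
      have -> : x = x'; last exact: connect0.
      case: x x' xD e1 e2 hc => [r q] [r' q'] /= + -> ; rewrite skewE /= => h hq hc.
      by congr pair; apply/val_inj => /=; lia.
    have q1 : (x.2.-1 < n)%N by have := ltn_ord x.2; lia.
    pose z : 'I_n * 'I_n := (x.1, Ordinal q1).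
    have zD : z \in D by move: xD; rewrite !skewE /=; lia.
    apply: (@connect_trans _ _ z); last by apply: IH => //=; lia.
    apply: connect1; rewrite /= xD zD /box_adj /= eqxx /=.
    by apply/orP; left; apply/orP; right; apply/eqP; lia.
  elim: d x => [|d IH] x xD; rewrite ?addn0 => hx.
    by apply: left => //=; [apply/val_inj; rewrite /= hx|rewrite hx].
  have hr := skew_row xD.
  have hc : (m x.1 < n)%N by apply: leq_trans hr (ln _).
  have r1 : (x.1.+1 < n)%N by lia.
  have hx1 : (t <= x.1 < j)%N by move: hr; rewrite hne; lia.
  pose z : 'I_n * 'I_n := (x.1, Ordinal hc).
  pose y : 'I_n * 'I_n := (Ordinal r1, Ordinal hc).
  have zD : z \in D by rewrite skewE /= leqnn.
  have yD : y \in D.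
    by rewrite skewE /=; have := h2 _ hx1; have := hm (leqnSn x.1); lia.
  apply: (@connect_trans _ _ z); first exact: left.
  apply: (@connect_trans _ _ y); last by apply: IH => //=; lia.
  by apply: connect1; rewrite /= zD yD /box_adj /= !eqxx /= orbT.
apply/negP => /existsP[x /existsP[y /and5P[/eqP e1 /eqP e2]]].
move=> xD _ /andP[_ yD].
have := skew_row xD; have := skew_row yD; rewrite !hne => hy hx.
have := h2 x.1; rewrite -e1.
move: xD yD; rewrite !skewE => /andP[x1 _] /andP[_ y1].
case/andP: hx => -> _; case/andP: hy => _ -> /(_ isT) E.
by move: y1; rewrite -E e2 ltnS ltnNge x1.
Qed.

Lemma strip_rows_height t j : strip_rows t j -> height D = (j - t).+1.
Proof.
move=> hs; have hne i := strip_rows_nonempty i hs.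
have jn : (j < n)%N by case: hs => /andP[].
have tj : (t <= j)%N by case: hs => /andP[].
have jt_n : ((j - t).+1 <= n)%N by lia.
have ok (c : 'I_(j - t).+1) : (t + c < n)%N by have := ltn_ord c; lia.
rewrite /height -[RHS]card_ord -(@card_imset _ _ (fun c => Ordinal (ok c))); last first.
  by move=> c d /(congr1 (@nat_of_ord _)) /= /addnI /val_inj.
apply: eq_card => i; apply/imsetP/imsetP => [[x xD ->]|[c _ ->]].
  have := skew_row xD.
  rewrite hne => /andP[tx xj].
  have hc : (x.1 - t < (j - t).+1)%N by rewrite ltnS leq_sub2r.
  by exists (Ordinal hc) => //; apply/val_inj => /=; rewrite subnKC.
have hr : (m (t + c) < l (t + c))%N.
  by rewrite hne leq_addr -leq_subRL // -ltnS ltn_ord.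
have hq : (m (t + c) < n)%N by apply: leq_trans hr (ln _).
by exists (Ordinal (ok c), Ordinal hq) => //; rewrite skewE /= leqnn.
Qed.

(** The row lengths telescope through the one-column overlaps: the strip has (l t - t) - (m j - j)
    boxes. *)
Lemma strip_rows_sum t j : strip_rows t j ->
  (\sum_(i < n.+1) l i + (t + m j) = \sum_(i < n.+1) m i + (l t + j))%N.
Proof.
move=> [/andP[tj jn] h1 h2 _ h4].
have tail : (\sum_(j.+1 <= i < n.+1) l i = \sum_(j.+1 <= i < n.+1) m i)%N.
  by rewrite big_nat_cond [RHS]big_nat_cond; apply: eq_bigr => i /andP[/andP[/h4 ->]].
have head : (\sum_(0 <= i < t) l i = \sum_(0 <= i < t) m i)%N.
  by rewrite big_nat_cond [RHS]big_nat_cond; apply: eq_bigr => i /andP[/andP[_ /h1 ->]].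
have mid : (\sum_(t <= i < j.+1) l i + (t + m j) = \sum_(t <= i < j.+1) m i + (l t + j))%N.
  have H d : (t + d <= j)%N -> (\sum_(t <= i < t + d) l i.+1 = \sum_(t <= i < t + d) m i + d)%N.
    elim: d => [|d IH] hd; first by rewrite addn0 !big_geq.
    rewrite addnS !big_nat_recr ?leq_addr //= IH; last lia.
    by rewrite -(h2 (t + d)%N) ?leq_addr //=; lia.
  have := H (j - t)%N; rewrite subnKC // => /(_ (leqnn _)) E.
  rewrite big_ltn // big_add1 /= E big_nat_recr //=; lia.
have split (f : nat -> nat) : (\sum_(i < n.+1) f i =
    \sum_(0 <= i < t) f i + (\sum_(t <= i < j.+1) f i + \sum_(j.+1 <= i < n.+1) f i))%N.
  by rewrite -(big_mkord predT) (@big_cat_nat _ _ _ t) //=; [|lia];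
    rewrite (@big_cat_nat _ _ _ j.+1 t) //=; lia.
rewrite (split l) (split m) tail head.
by move: mid; move: (\sum_(t <= i < _) l i)%N (\sum_(t <= i < _) m i)%N => A B; lia.
Qed.
End BorderStrips.

(** * From shifted exponents to Young diagrams *)

Section Partitions.
Variable n : nat.
Local Notation L := n.+1.

Definition shape_mnm (s : seq nat) : 'X_{1..L} := [multinom nth 0%N s i | i < L].

Lemma nth_leq_sumn (s : seq nat) i : (nth 0%N s i <= sumn s)%N.
Proof.
elim: s i => [|x s IH] [|i] //=; first exact: leq_addr.
by apply: leq_trans (IH i) _; apply: leq_addl.
Qed.

Lemma sum_nth (s : seq nat) N : (size s <= N)%N ->
  (\sum_(i < N) nth 0%N s i = sumn s)%N.
Proof.
elim: s N => [|x s IH] [|N] //= hs.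
- by rewrite big_ord0.
- by rewrite big1 // => i _; rewrite nth_nil.
by rewrite big_ord_recl /= IH.
Qed.

Lemma sorted_nth (s : seq nat) : sorted geq s ->
  forall i k, (i <= k)%N -> (nth 0%N s k <= nth 0%N s i)%N.
Proof.
move=> so i k ik; have [ks|sk] := ltnP k (size s); last by rewrite (nth_default _ sk).
apply: (@sorted_leq_nth _ geq _ _ 0%N _ so i k) => //.
- by move=> a b c /= h1 h2; apply: leq_trans h2 h1.
- by move=> a /=.
by rewrite inE; apply: leq_ltn_trans ks.
Qed.

Lemma partition_facts la : is_partition n la ->
  [/\ forall i k, (i <= k)%N -> (nth 0%N la k <= nth 0%N la i)%N,
      forall i, (nth 0%N la i <= n)%N, forall i, (n <= i)%N -> nth 0%N la i = 0%N,
      (size la <= n)%N & (\sum_(i < L) nth 0%N la i = n)%N].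
Proof.
move=> /and3P[so h0 /eqP hs].
have sz : (size la <= n)%N.
  rewrite -hs; elim: la {so hs} h0 => //= x s IH; rewrite inE negb_or => /andP[x0 /IH].
  by case: x x0 => // x _; rewrite addSn ltnS => h; apply: leq_trans h (leq_addl _ _).
split=> //.
- exact: sorted_nth.
- by move=> i; rewrite -[X in (_ <= X)%N]hs nth_leq_sumn.
- by move=> i ni; rewrite nth_default // (leq_trans sz).
by rewrite sum_nth ?hs // (leq_trans sz).
Qed.

(** Adding [delta] turns the overlap condition [(m i).+1 = l i.+1] into equality of entry i of the
    smaller exponent with entry i + 1 of the larger; the size k matches by [strip_rows_sum]. *)
Lemma strict_strip_rows la a b k (t j : 'I_L) : (0 < n)%N -> (0 < k)%N ->
    is_partition n la -> (b <= a)%N -> (a + b + k = n)%N ->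
  rim (delta n + shape_mnm la)%MM (delta n + rows2 n a b)%MM k t j
  <-> strip_rows n la [:: a; b] t j.
Proof.
move=> n0 k0 /partition_facts[hl ln l0 _ sl] ba abk.
have m0 i : (n <= i)%N -> nth 0%N [:: a; b] i = 0%N.
  by move=> ni; case: i ni => [|[|i]] /=; rewrite ?nth_nil //; lia.
have hm : forall i k, (i <= k)%N -> (nth 0%N [:: a; b] k <= nth 0%N [:: a; b] i)%N.
  by apply: sorted_nth; rewrite /= ba.
have sm : (\sum_(i < L) nth 0%N [:: a; b] i = a + b)%N.
  by rewrite sum_nth /= ?addn0.
have E i : (delta n + shape_mnm la)%MM i = (n - i + nth 0%N la i)%N.
  by rewrite mnmDE deltaE mnmE.
have Em i : (delta n + rows2 n a b)%MM i = (n - i + nth 0%N [:: a; b] i)%N.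
  by rewrite mnmDE deltaE mnmE.
set m := nth 0%N [:: a; b] in hm m0 sm Em *; set l := nth 0%N la in hl ln l0 sl E *.
split.
  move=> [tj h1 h2]; rewrite E Em => h3 h4.
  (* There are n + 1 variables but only n rows in the grid, so a strip ending in row n, which is
     empty in la, has to be ruled out. *)
  have jn : (j < n)%N.
    rewrite ltnNge; apply/negP => nj; have jE : j = n :> nat by have := ltn_ord j; lia.
    have [tj'|jt] := ltnP t j.
      have jL : (j.-1 < L)%N by have := ltn_ord j; lia.
      have := h2 (Ordinal jL) j; rewrite /= prednK; last by lia.
      by move=> /(_ erefl); rewrite E Em /= l0 //; lia.
    have tE : t = j by apply/val_inj/eqP; rewrite eqn_leq tj jt.
    by move: h3; rewrite tE l0 //; lia.
  have H1 i : (i < t)%N -> m i = l i.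
    move=> it; have iL : (i < L)%N by have := ltn_ord t; lia.
    by have := h1 (Ordinal iL) it; rewrite E Em => /addnI.
  have H4 i : (j < i)%N -> m i = l i.
    move=> ji; have [ni|ni] := leqP n i; first by rewrite l0 ?m0.
    by have := h4 (Ordinal (ltnW ni : i < L)%N) ji; rewrite E Em => /addnI.
  have H2 i : (t <= i < j)%N -> (m i).+1 = l i.+1.
    move=> hi; have iL : (i < L)%N by lia.
    have i1L : (i.+1 < L)%N by lia.
    have := h2 (Ordinal iL) (Ordinal i1L) erefl hi; rewrite E Em /=; lia.
  split=> //; first by rewrite tj.
  rewrite -/(m j) -/(l j); have [tj'|jt] := ltnP t j.
    have := H2 j.-1; rewrite prednK; last by lia.
    have := hm _ _ (leq_pred j); lia.
  have tE : t = j by apply/val_inj/eqP; rewrite eqn_leq tj jt.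
  by move: h3; rewrite tE; lia.
move=> hs; have := strip_rows_sum hs; rewrite -/l -/m sl sm => hsum.
case: hs => /andP[tj jn] h1 h2 h3 h4; split=> //.
- by move=> i it; rewrite E Em /m /l h1.
- by move=> i i' ii hi; have hi' := h2 i hi; rewrite E Em ii /l -hi' -/m; move: hi; lia.
- rewrite E Em; move: hsum; lia.
by move=> i ji; rewrite E Em /m /l h4.
Qed.

Lemma strip_coefficient (R : numFieldType) la a b k : (0 < n)%N -> (0 < k)%N ->
    is_partition n la -> (b <= a)%N -> (a + b + k = n)%N ->
  let u := (delta n + shape_mnm la)%MM in
  \sum_(i | (k <= u i)%N)
     (alternant R (delta n + rows2 n a b)%MM)@_(u - U_(i) *+ k)%MM
  = if skew_is_border_strip n la [:: a; b]
    then (-1) ^+ (height (diagram n la :\: diagram n [:: a; b]) + 1) else 0.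
Proof.
move=> n0 k0 hla ba abk u.
have key t j := strict_strip_rows t j n0 k0 hla ba abk.
have [hl ln l0 _ sl] := partition_facts hla.
have m0 i : (n <= i)%N -> nth 0%N [:: a; b] i = 0%N.
  by move=> ni; case: i ni => [|[|i]] /=; rewrite ?nth_nil //; lia.
have hm : forall i k, (i <= k)%N -> (nth 0%N [:: a; b] k <= nth 0%N [:: a; b] i)%N.
  by apply: sorted_nth; rewrite /= ba.
have mn i : (nth 0%N [:: a; b] i <= n)%N.
  by apply: leq_trans (nth_leq_sumn _ _) _; rewrite /= addn0; lia.
have su : strict u.
  by apply: strict_shift => i c ic; rewrite !mnmE; apply: hl.
have sv : strict (delta n + rows2 n a b)%MM.
  by apply: strict_shift; apply: rows2_decr.
case: ifP => hS; last first.
  apply: murnaghan_nakayama0 => // t j /key hs.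
  by move: hS; rewrite (strip_rows_strip hl hm ln hs).
(* Since k > 0 the two shapes have different sizes, so the skew diagram is not empty. *)
have hex : exists i, nth 0%N [:: a; b] i != nth 0%N la i.
  have [i hi|h0] := pickP (fun i : 'I_L => nth 0%N [:: a; b] i != nth 0%N la i).
    by exists i.
  move: sl; rewrite -(eq_bigr _ (fun i _ => eqP (negbFE (h0 i)))) sum_nth //=; lia.
have [t [j hs]] := strip_rows_exist hl hm ln mn l0 m0 hex hS.
have jn : (j < n)%N by case: hs => /andP[].
have tj : (t <= j)%N by case: hs => /andP[].
have tL : (t < L)%N by lia.
have jL : (j < L)%N by lia.
have hr := (key (Ordinal tL) (Ordinal jL)).2 hs.
rewrite (murnaghan_nakayama _ su sv k0 hr) (strip_rows_height hl ln hs) /=.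
(* The height is j - t + 1, so height + 1 has the parity of t + j. *)
by rewrite -signr_odd -[RHS]signr_odd; congr (_ ^+ nat_of_bool _); lia.
Qed.
End Partitions.

(** * The regular representation and the Young symmetrizer *)

Section Tableau.
Variables (n : nat) (la : seq nat).
Hypothesis hla : is_partition n la.
Local Notation L := n.+1.

Definition row_word : {ffun 'I_n -> 'I_L} := [ffun i : 'I_n => inord (reshape_index la i)].
Definition col_word : {ffun 'I_n -> 'I_L} := [ffun i : 'I_n => inord (reshape_offset la i)].

Let sla : sumn la = n. Proof. by have /and3P[_ _ /eqP] := hla. Qed.
Let hl i k : (i <= k)%N -> (nth 0%N la k <= nth 0%N la i)%N.
Proof. by have [h _ _ _ _] := partition_facts hla; apply: h. Qed.

Lemma row_wordE i : row_word i = reshape_index la i :> nat.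
Proof.
rewrite ffunE inordK //; have [_ _ _ sz _] := partition_facts hla.
have := @reshape_indexP la i; rewrite sla ltn_ord => /(_ isT); lia.
Qed.

Lemma col_word_lt (i : 'I_n) : (reshape_offset la i < nth 0%N la (row_word i))%N.
Proof. by rewrite row_wordE reshape_offsetP // sla. Qed.

Lemma col_wordE i : col_word i = reshape_offset la i :> nat.
Proof.
rewrite ffunE inordK // ltnS; apply/ltnW/(leq_trans (col_word_lt i)).
by have [_ h _ _ _] := partition_facts hla.
Qed.

Lemma word_inj i j : row_word i = row_word j -> col_word i = col_word j -> i = j.
Proof.
move=> /(congr1 (@nat_of_ord _)); rewrite !row_wordE => hr.
move=> /(congr1 (@nat_of_ord _)); rewrite !col_wordE => hc.
apply/val_inj; by rewrite -[LHS](reshape_indexK la) -[RHS](reshape_indexK la) hr hc.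
Qed.

Lemma word_surj (r c : nat) : (c < nth 0%N la r)%N ->
  exists i, row_word i = r :> nat /\ col_word i = c :> nat.
Proof.
move=> hc; have rs : (r < size la)%N.
  by rewrite ltnNge; apply/negP => h; move: hc; rewrite nth_default.
have hi : (flatten_index la r c < n)%N by rewrite -sla flatten_indexP.
exists (Ordinal hi); rewrite row_wordE col_wordE /=.
by rewrite flatten_indexKl // flatten_indexKr.
Qed.

Lemma row_stabE : row_stab n la = wstab row_word.
Proof.
apply/setP=> s; rewrite !inE; apply: eq_forallb => i.
by rewrite -val_eqE /= !row_wordE.
Qed.

Lemma col_stabE : col_stab n la = wstab col_word.
Proof.
apply/setP=> s; rewrite !inE; apply: eq_forallb => i.
by rewrite -val_eqE /= !col_wordE.
Qed.

Lemma content_row_word (t : 'I_L) : content row_word t = nth 0%N la t.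
Proof.
have [hn _ _ _] : [/\ (nth 0%N la t <= n)%N, true, true & true].
  by have [_ h _ _ _] := partition_facts hla; split.
have ex (c : 'I_(nth 0%N la t)) : exists i, (row_word i == t) && (col_word i == c :> nat).
  have [i [h1 h2]] := word_surj (ltn_ord c).
  by exists i; rewrite -val_eqE /= h1 h2 !eqxx.
pose f c := xchoose (ex c).
have fP c : row_word (f c) = t /\ col_word (f c) = c :> nat.
  by have /andP[/eqP h1 /eqP h2] := xchooseP (ex c).
rewrite /content -[RHS]card_ord -(@card_imset _ _ f); last first.
  move=> c d fcd; apply/val_inj => /=.
  by rewrite -(fP c).2 -(fP d).2 fcd.
apply: eq_card => i; rewrite inE; apply/eqP/imsetP => [rit|[c _ ->]]; last exact: (fP c).1.
have hc : (col_word i < nth 0%N la t)%N by rewrite -rit col_wordE col_word_lt.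
exists (Ordinal hc) => //; apply: word_inj; first by rewrite (fP _).1.
by apply/val_inj; rewrite /= (fP _).2.
Qed.

Definition transverse (r : {ffun 'I_n -> 'I_L}) :=
  [forall i, forall j, (r i == r j) && (col_word i == col_word j) ==> (i == j)].

Lemma transverseP (r : {ffun 'I_n -> 'I_L}) :
  reflect (forall i j, r i = r j -> col_word i = col_word j -> i = j) (transverse r).
Proof.
apply: (iffP forallP) => h i; last first.
  by apply/forallP=> j; apply/implyP=> /andP[/eqP h1 /eqP h2]; rewrite (h i j).
by move=> j h1 h2; have /forallP/(_ j)/implyP := h i; rewrite h1 h2 !eqxx => /(_ isT)/eqP.
Qed.

Lemma transversePn (r : {ffun 'I_n -> 'I_L}) : ~~ transverse r ->
  exists i j, [/\ i != j, r i = r j & col_word i = col_word j].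
Proof.
move=> /forallPn[i /forallPn[j]]; rewrite negb_imply => /andP[/andP[/eqP h1 /eqP h2] ij].
by exists i, j.
Qed.

(** If column c reaches row t or lower, it has a box in each of the first t rows, and the right side
    is at least t, which bounds the number of distinct letters below t. Otherwise the right side
    counts the whole column. *)
Lemma transverse_column (r : {ffun 'I_n -> 'I_L}) (c : 'I_L) (t : nat) : transverse r ->
  (#|[set x | (col_word x == c) && (r x < t)]|
   <= #|[set x | (col_word x == c) && (row_word x < t)]|)%N.
Proof.
move=> /transverseP hr.
have [y /andP[/eqP yc ty]|h0] := pickP (fun y => (col_word y == c) && (t <= row_word y)%N).
  apply: (@leq_trans t).
    have hinj : {in [set x | (col_word x == c) && (r x < t)%N] &, injective r}.
      by move=> x x'; rewrite !inE => /andP[/eqP hc _] /andP[/eqP hc' _] /hr; apply; rewrite hc.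
    rewrite -(card_in_imset hinj).
    have [->|t0] := posnP t.
      rewrite leqn0 cards_eq0; apply/eqP/setP => x; rewrite inE.
      by apply/imsetP => -[z]; rewrite inE ltn0 andbF.
    rewrite -[X in (_ <= X)%N]card_ord.
    pose h (x : 'I_L) : 'I_t := insubd (Ordinal t0) (x : nat).
    have hE (x : 'I_L) : (x < t)%N -> h x = x :> nat.
      by move=> xt; rewrite /h val_insubd xt.
    apply: leq_trans (max_card (mem (h @: (r @: [set x | (col_word x == c) && (r x < t)%N])))).
    rewrite [X in (_ <= X)%N]card_in_imset // => x x' /imsetP[z + ->] /imsetP[z' + ->].
    rewrite !inE => /andP[_ zt] /andP[_ zt'] /(congr1 (@nat_of_ord _)).
    by rewrite !hE // => /val_inj.
  have ex (i : 'I_t) : exists x, (row_word x == i :> nat) && (col_word x == c).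
    have hc : (c < nth 0%N la i)%N.
      apply: (@leq_trans (nth 0%N la (row_word y))).
        by rewrite -yc col_wordE col_word_lt.
      by apply/hl/ltnW/(leq_trans (ltn_ord i)).
    have [x [h1 h2]] := word_surj hc; exists x.
    by rewrite h1 -val_eqE /= h2 !eqxx.
  have fP i := xchooseP (ex i).
  rewrite -[X in (X <= _)%N]card_ord -(@card_imset _ _ (fun i => xchoose (ex i))); last first.
    move=> i j hij; apply/val_inj.
    have /andP[/eqP h1 _] := fP i; have /andP[/eqP h2 _] := fP j.
    exact: etrans (esym h1) (etrans (congr1 (fun x => nat_of_ord (row_word x)) hij) h2).
  apply/subset_leq_card/subsetP => _ /imsetP[i _ ->].
  by have /andP[/eqP h1 h2] := fP i; rewrite inE h2 h1 /=.
apply/subset_leq_card/subsetP => x; rewrite !inE => /andP[xc _].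
by rewrite xc /= ltnNge; have := h0 x; rewrite xc /= => ->.
Qed.

Lemma card_below (r : {ffun 'I_n -> 'I_L}) t :
  (\sum_(c : 'I_L) #|[set x | (col_word x == c) && (r x < t)]|
   = \sum_(i : 'I_L | i < t) content r i)%N.
Proof.
transitivity #|[set x | (r x < t)%N]|.
  rewrite -[RHS]sum1_card (partition_big col_word predT) //=.
  apply: eq_bigr => c _; rewrite -sum1_card; apply: eq_bigl => x.
  by rewrite !inE andbC.
rewrite -sum1_card (partition_big r (fun i : 'I_L => (i < t)%N)) /=; last first.
  by move=> x; rewrite inE.
apply: eq_bigr => i it; rewrite /content -sum1_card; apply: eq_bigl => x.
by rewrite !inE; case: eqP => [->|]; rewrite ?andbF ?it.
Qed.

Lemma transverse_dominance (r : {ffun 'I_n -> 'I_L}) (t : nat) : transverse r ->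
  (\sum_(i : 'I_L | i < t) content r i <= \sum_(i : 'I_L | i < t) nth 0%N la i)%N.
Proof.
move=> hr; rewrite -card_below.
rewrite -(eq_bigr _ (fun i _ => content_row_word i)) -card_below.
by apply: leq_sum => c _; apply: transverse_column.
Qed.

(** With equal contents the column inequalities have equal sums, hence are all equalities.
    Differences in t then show that each column carries the same letters in r as in [row_word], so a
    column permutation relates the two. *)
Lemma transverse_perm (r : {ffun 'I_n -> 'I_L}) : transverse r -> content r =1 content row_word ->
  exists2 s, s \in wstab col_word & r = wact row_word s.
Proof.
move=> hr hc.
have eqc (c : 'I_L) t : #|[set x | (col_word x == c) && (r x < t)%N]|
    = #|[set x | (col_word x == c) && (row_word x < t)%N]|.
  have E : (\sum_(c : 'I_L) #|[set x | (col_word x == c) && (r x < t)%N]|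
      = \sum_(c : 'I_L) #|[set x | (col_word x == c) && (row_word x < t)%N]|)%N.
    by rewrite !card_below; apply: eq_bigr => i _; apply: hc.
  apply/eqP; rewrite eqn_leq transverse_column //= leqNgt; apply/negP => hlt.
  move: E; rewrite (bigD1 c) //= [in RHS](bigD1 c) //=.
  have : (\sum_(i | i != c) #|[set x | (col_word x == i) && (r x < t)%N]| <=
     \sum_(i | i != c) #|[set x | (col_word x == i) && (row_word x < t)%N]|)%N.
    by apply: leq_sum => i _; apply: transverse_column.
  move: (\sum_(i | _) _)%N (\sum_(i | _) _)%N hlt => A B; lia.
pose z (w : {ffun 'I_n -> 'I_L}) : {ffun 'I_n -> 'I_L * 'I_L} :=
  [ffun i => (w i, col_word i)].
have cz w i c : (content (z w) (i, c) + #|[set x | (col_word x == c) && (w x < i)%N]|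
    = #|[set x | (col_word x == c) && (w x < i.+1)%N]|)%N.
  rewrite -cardsUI [X in (_ + X)%N](_ : _ = 0%N) ?addn0; last first.
    apply/eqP; rewrite cards_eq0; apply/eqP/setP=> x.
    rewrite !inE ffunE xpair_eqE; apply/negP => /andP[/andP[/eqP -> _] /andP[_]].
    by rewrite ltnn.
  apply: eq_card => x; rewrite !inE ffunE xpair_eqE ltnS [in RHS]leq_eqVlt -val_eqE /=.
  by rewrite [in RHS]andb_orr andbC.
have [|s hs] := @content_transitive _ _ (z row_word) (z r).
  by move=> [i c]; have := cz r i c; have := cz row_word i c; rewrite !eqc; lia.
have H i : r i = row_word (s i) /\ col_word i = col_word (s i).
  by have /ffunP/(_ i) := hs; rewrite !ffunE => -[].
exists s; first by apply/wstabP=> i; rewrite -(H i).2.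
by apply/ffunP=> i; rewrite ffunE (H i).1.
Qed.

(** The word [row_word] transported by g is tested. If it is transverse, it is a column
    rearrangement of [row_word], which factors g; otherwise a letter repeated within a column
    supplies the transposition. *)
Lemma von_neumann_dichotomy (g : 'S_n) :
  (exists p q, [/\ p \in row_stab n la, q \in col_stab n la & g = (p * q)%g]) \/
  (exists i j, [/\ i != j, tperm i j \in row_stab n la &
                  tperm (g i) (g j) \in col_stab n la]).
Proof.
rewrite row_stabE col_stabE.
have [hr|/transversePn[i [j [ij]]]] := boolP (transverse (wact row_word g^-1)%g).
  left; have [s hs E] := transverse_perm hr (content_wact _ _).
  exists (g * s)%g, (s^-1)%g; rewrite wstabV ?mulgK //; split=> //.
  apply/wstabP=> i; rewrite permM.
  by have /ffunP/(_ (g i)) := E; rewrite !ffunE permK => <-.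
rewrite !ffunE => h1 h2; right; exists ((g^-1)%g i), ((g^-1)%g j).
rewrite (inj_eq perm_inj) ij !permKV; split=> //; apply: wstab_tperm; rewrite !ffunE //.
Qed.
End Tableau.

(** * The group algebra inside the regular representation *)

Section RegularRep.
Variables (C : numClosedFieldType) (gT : finGroupType).
Local Notation G := [set: gT].
Local Notation N := #|[set: gT]|.

Definition rho (g : gT) : 'M[C]_N := regular_repr C [group of G] g.

Lemma rhoM x y : rho (x * y)%g = rho x *m rho y.
Proof. by rewrite /rho repr_mxM ?in_setT. Qed.

Lemma rho1 : rho 1%g = 1%:M.
Proof. exact: repr_mx1. Qed.

Lemma natN_neq0 : (N%:R : C) != 0.
Proof. by rewrite pnatr_eq0 -lt0n cardG_gt0. Qed.

Lemma tr_rho g : \tr (rho g) = N%:R * (g == 1%g)%:R.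
Proof.
have E i : rho g i i = (g == 1%g)%:R.
  rewrite /rho /= !mxE eqxx /=; congr (nat_of_bool _)%:R.
  rewrite -{1}(gring_valK i) (inj_in_eq (can_in_inj (@gring_indexK _ _))) ?inE //.
  by rewrite -{1}[enum_val i]mulg1 (inj_eq (mulgI _)) eq_sym.
rewrite /mxtrace (eq_bigr _ (fun i _ => E i)) sumr_const card_ord.
by rewrite mulr_natl.
Qed.

(* The coefficient of [h^-1] in an element [X] of the group algebra. *)
Definition coef (X : 'M[C]_N) (h : gT) : C := \tr (X *m rho h) / N%:R.

Lemma coef_rho x h : coef (rho x) h = ((x * h)%g == 1%g)%:R.
Proof. by rewrite /coef -rhoM tr_rho mulrC mulKf // natN_neq0. Qed.

Lemma coefD X Y h : coef (X + Y) h = coef X h + coef Y h.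
Proof. by rewrite /coef mulmxDl raddfD mulrDl. Qed.

Lemma coefZ (a : C) X h : coef (a *: X) h = a * coef X h.
Proof. by rewrite /coef -scalemxAl mxtraceZ mulrA. Qed.

Lemma coef_sum (I : finType) (P : pred I) (F : I -> 'M[C]_N) h :
  coef (\sum_(i | P i) F i) h = \sum_(i | P i) coef (F i) h.
Proof. by rewrite /coef mulmx_suml raddf_sum mulr_suml. Qed.

Definition in_span X := X = \sum_(g : gT) coef X g^-1%g *: rho g.

Lemma span_rho x : in_span (rho x).
Proof.
rewrite /in_span (bigD1 x) //= coef_rho mulgV eqxx scale1r big1 ?addr0 // => g gx.
by rewrite coef_rho -eq_mulgV1 eq_sym (negbTE gx) scale0r.
Qed.

Lemma spanD X Y : in_span X -> in_span Y -> in_span (X + Y).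
Proof.
rewrite /in_span => {1}-> {1}->; rewrite -big_split; apply: eq_bigr => g _.
by rewrite /= coefD scalerDl.
Qed.

Lemma span0 : in_span 0.
Proof.
by rewrite /in_span big1 // => g _; rewrite /coef mul0mx mxtrace0 mul0r scale0r.
Qed.

Lemma spanZ a X : in_span X -> in_span (a *: X).
Proof.
rewrite /in_span => {1}->; rewrite scaler_sumr; apply: eq_bigr => g _.
by rewrite coefZ scalerA.
Qed.

Lemma span_sum (I : finType) (P : pred I) (F : I -> 'M[C]_N) :
  (forall i, P i -> in_span (F i)) -> in_span (\sum_(i | P i) F i).
Proof. by move=> h; apply: big_ind => //; [exact: span0|exact: spanD]. Qed.

Lemma spanM X Y : in_span X -> in_span Y -> in_span (X *m Y).
Proof.
move=> -> ->; rewrite mulmx_suml; apply: span_sum => x _.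
rewrite mulmx_sumr; apply: span_sum => y _.
by rewrite -scalemxAl -scalemxAr -rhoM; do 2 apply: spanZ; apply: span_rho.
Qed.

Lemma central_comm (f : gT -> C) (hf : forall x y, f (x ^ y)%g = f x) x :
  rho x *m (\sum_g f g *: rho g) = (\sum_g f g *: rho g) *m rho x.
Proof.
rewrite mulmx_sumr mulmx_suml (reindex_inj (conjg_inj x)) /=.
apply: eq_bigr => g _; rewrite hf -scalemxAr -scalemxAl -!rhoM; congr (_ *: rho _).
by rewrite -conjgC.
Qed.

(** Row i holds the coordinates of X times the i-th group element. The row space is thus the cyclic
    submodule generated by X, and its dimension is a rank. *)
Definition left_mult (X : 'M[C]_N) : 'M[C]_N :=
  \matrix_i (gring_row X *m rho (enum_val i)).

Lemma cyclic_left_mult X :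
  cyclic_mx (regular_repr C [group of G]) (gring_row X) = <<left_mult X>>%MS.
Proof.
rewrite /cyclic_mx; congr <<_>>%MS; apply/row_matrixP=> i.
by rewrite row_mul mul_rV_lin1 /= rowK mxvecK rowK.
Qed.

(** Left and right multiplication by a group element both have trace the group order at the identity
    and 0 elsewhere. *)
Lemma left_mult_trace X : in_span X -> \tr (left_mult X) = \tr X.
Proof.
have H x : \tr (left_mult (rho x)) = \tr (rho x).
  rewrite tr_rho /mxtrace.
  have E i : left_mult (rho x) i i = (x == 1%g)%:R.
    rewrite mxE -gring_row_mul -rhoM /gring_row /rho /= rowK mxE eqxx /=.
    rewrite gring_indexK ?inE // mul1g; congr (nat_of_bool _)%:R.
    rewrite -{1}(gring_valK i) (inj_in_eq (can_in_inj (@gring_indexK _ _))) ?inE //.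
    by rewrite -{1}[enum_val i]mul1g (inj_eq (mulIg _)) eq_sym.
  by rewrite (eq_bigr _ (fun i _ => E i)) sumr_const card_ord mulr_natl.
have lin : left_mult (\sum_(g : gT) coef X g^-1%g *: rho g) =
    \sum_(g : gT) coef X g^-1%g *: left_mult (rho g).
  apply/row_matrixP=> i; rewrite rowK linear_sum mulmx_suml linear_sum.
  by apply: eq_bigr => g _; rewrite linearZ /= -scalemxAl linearZ /= rowK.
move=> hX; rewrite {1}hX lin [in RHS]hX !linear_sum; apply: eq_bigr => g _.
by rewrite /= !linearZ /= H.
Qed.

Lemma left_mult_square X (k : C) : in_span X -> X *m X = k *: X ->
  left_mult X *m left_mult X = k *: left_mult X.
Proof.
move=> hX hk; apply/row_matrixP=> i; rewrite row_mul linearZ /= !rowK.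
set v := _ *m rho _.
(* Multiplying coordinates by [left_mult X] puts X on the left of the element with coordinates v. *)
have -> : v *m left_mult X = gring_row X *m gring_mx (regular_repr C [group of G]) v.
  rewrite [v in LHS]row_sum_delta mulmx_suml.
  rewrite /gring_mx /= [v *m _]mulmx_sum_row linear_sum mulmx_sumr.
  apply: eq_bigr => j _; rewrite linearZ /= -scalemxAr -scalemxAl; congr (_ *: _).
  by rewrite -rowE !rowK mxvecK.
rewrite gring_mxJ ?inE // mulmxA -/(rho _).
have -> : gring_mx (regular_repr C [group of G]) (gring_row X) = X.
  rewrite -gring_opE [in LHS]hX [RHS]hX linear_sum; apply: eq_bigr => g _.
  by rewrite linearZ /= gring_opG ?inE.
by rewrite -gring_row_mul hk linearZ /= scalemxAl.
Qed.
End RegularRep.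

(** In a full-rank factorisation T = X Y, cancelling X on the left and Y on the right of X Y X Y = k
    X Y leaves Y X = k I, whose size is the rank. *)
Lemma trace_quasi_idempotent (F : fieldType) m (T : 'M[F]_m) (k : F) :
  T *m T = k *: T -> \tr T = k * (\rank T)%:R.
Proof.
move=> hT; have /row_fullP[B hB] := col_base_full T.
have /row_freeP[D hD] := row_base_free T.
move: (mulmx_base T) hB hD; move: (col_base T) (row_base T) B D.
move: (\rank T) => r X Y B D hXY hB hD.
have E : Y *m X = k%:M.
  have := congr1 (fun Z => B *m Z *m D) hT.
  rewrite -hXY -scalemxAr -!scalemxAl !mulmxA hB !mul1mx.
  by rewrite -!mulmxA hD !mulmx1 scalemx1.
by rewrite -hXY mxtrace_mulC E mxtrace_scalar mulr_natr.
Qed.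

(** * The Young symmetrizer and its averaged coefficients *)

Section YoungSymmetrizer.
Variables (C : numClosedFieldType) (n : nat) (la : seq nat).
Hypothesis hla : is_partition n la.
Local Notation L := n.+1.
Local Notation rho := (rho C).
Local Notation N := #|[set: 'S_n]|.
Local Notation P := (row_stab n la).
Local Notation Q := (col_stab n la).
Local Notation rw := (row_word n la).

Let a : 'M[C]_N := \sum_(p in P) rho p.
Let b : 'M[C]_N := \sum_(q in Q) (-1) ^+ q *: rho q.
Let c : 'M[C]_N := young_symmetrizer C n la.

Let cE : c = a *m b. Proof. by []. Qed.

Lemma stab_sum (w : {ffun 'I_n -> 'I_L}) p : p \in wstab w ->
  rho p *m \sum_(x in wstab w) rho x = \sum_(x in wstab w) rho x.
Proof.
move=> hp; rewrite mulmx_sumr [RHS](reindex_inj (mulgI p)) /=.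
apply: eq_big => [x|x _]; last by rewrite rhoM.
apply/idP/idP => h; first exact: wstabM.
by rewrite -(mulKg p x) wstabM ?wstabV.
Qed.

Let a_stab : a = \sum_(x in wstab rw) rho x.
Proof. by apply: eq_bigl => x; rewrite row_stabE. Qed.

Let row_mul p : p \in P -> rho p *m a = a.
Proof. by rewrite a_stab row_stabE //; apply: stab_sum. Qed.

Let mul_row p : p \in P -> a *m rho p = a.
Proof.
rewrite row_stabE // => hp; rewrite a_stab mulmx_suml [RHS](reindex_inj (mulIg p)) /=.
apply: eq_big => [x|x _]; last by rewrite rhoM.
apply/idP/idP => h; first exact: wstabM.
by rewrite -(mulgK p x) wstabM ?wstabV.
Qed.

Let col_mul q : q \in Q -> rho q *m b = (-1) ^+ q *: b.
Proof.
rewrite col_stabE // => hq; rewrite mulmx_sumr scaler_sumr [RHS](reindex_inj (mulgI q)) /=.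
apply: eq_big => [x|x _]; rewrite ?col_stabE //.
  apply/idP/idP => h; first exact: wstabM.
  by rewrite -(mulKg q x) wstabM ?wstabV.
by rewrite -scalemxAr -rhoM odd_permM signr_addb scalerA mulrA -signr_addb addbb mul1r.
Qed.

Let mul_col q : q \in Q -> b *m rho q = (-1) ^+ q *: b.
Proof.
rewrite col_stabE // => hq; rewrite mulmx_suml scaler_sumr [RHS](reindex_inj (mulIg q)) /=.
apply: eq_big => [x|x _]; rewrite ?col_stabE //.
  apply/idP/idP => h; first exact: wstabM.
  by rewrite -(mulgK q x) wstabM ?wstabV.
rewrite -scalemxAl -rhoM odd_permM scalerA -signr_addb.
by rewrite [odd_perm x (+) _]addbC addbA addbb.
Qed.

Let eq_opp0 (X : 'M[C]_N) : X = - X -> X = 0.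
Proof.
by move/eqP; rewrite -addr_eq0 -mulr2n -scaler_nat scaler_eq0 pnatr_eq0 /= => /eqP.
Qed.

(** If g = p q, then a absorbs p and b absorbs q up to sign. Otherwise a transposition absorbed by a
    crosses g and changes the sign of b, so the product is its own opposite. *)
Let sandwich g : exists s, a *m rho g *m b = s *: c.
Proof.
have [[p [q [hp hq ->]]]|[i [j [ij hi hj]]]] := von_neumann_dichotomy hla g.
  by exists ((-1) ^+ q); rewrite rhoM mulmxA mul_row // -mulmxA col_mul // -scalemxAr.
exists 0; rewrite scale0r; apply: eq_opp0.
rewrite -{1}(mul_row hi) -!mulmxA [rho _ *m _]mulmxA -rhoM.
have -> : (tperm i j * g = g * tperm (g i) (g j))%g by rewrite -tpermJ conjgC.
rewrite rhoM -mulmxA col_mul // odd_tperm (inj_eq perm_inj) ij expr1 scaleN1r.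
by rewrite !mulmxN.
Qed.

Let sandwich' g : exists s, b *m rho g *m a = s *: (b *m a).
Proof.
have [[p [q [hp hq E]]]|[i [j [ij hi hj]]]] := von_neumann_dichotomy hla g^-1%g.
  have -> : g = (q^-1 * p^-1)%g by rewrite -invMg -E invgK.
  exists ((-1) ^+ (q^-1)%g); rewrite rhoM mulmxA mul_col.
    rewrite -!scalemxAl -mulmxA row_mul //.
    by move: hp; rewrite row_stabE // => /wstabV.
  by move: hq; rewrite col_stabE // => /wstabV.
exists 0; rewrite scale0r; apply: eq_opp0.
rewrite -{1}(row_mul hi) -!mulmxA [rho g *m (_ *m _)]mulmxA -rhoM.
have -> : (g * tperm i j = tperm (g^-1 i) (g^-1 j) * g)%g.
  by rewrite -tpermJ conjgE invgK -!mulgA mulVg mulg1.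
rewrite rhoM !mulmxA mul_col // odd_tperm (inj_eq perm_inj) ij expr1.
by rewrite scaleN1r !mulNmx.
Qed.

Let span_a : in_span a. Proof. by apply: span_sum => p _; apply: span_rho. Qed.
Let span_b : in_span b.
Proof. by apply: span_sum => q _; apply: spanZ; apply: span_rho. Qed.
Lemma span_young : in_span c. Proof. exact: spanM. Qed.

Local Notation cc := (coef c).

Let coef_ab h : coef c h = \sum_(p in P) \sum_(q in Q) (-1) ^+ q * ((p * q * h)%g == 1%g)%:R.
Proof.
rewrite cE mulmx_suml coef_sum; apply: eq_bigr => p _.
rewrite mulmx_sumr coef_sum; apply: eq_bigr => q _.
by rewrite -scalemxAr coefZ -rhoM coef_rho.
Qed.

Let coef_ba h : coef (b *m a) h =
  \sum_(p in P) \sum_(q in Q) (-1) ^+ q * ((q * p * h)%g == 1%g)%:R.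
Proof.
rewrite exchange_big mulmx_suml coef_sum; apply: eq_bigr => q _.
rewrite mulmx_sumr coef_sum; apply: eq_bigr => p _.
by rewrite -scalemxAl coefZ -rhoM coef_rho.
Qed.

(** Inversion of group elements is an anti-automorphism fixing a and b, so it exchanges a b and b
    a. *)
Let coef_inv h : cc h^-1%g = coef (b *m a) h.
Proof.
rewrite coef_ab coef_ba (reindex_inj invg_inj) /=.
apply: eq_big => [p|p _].
  by rewrite row_stabE //; apply/idP/idP => /wstabV; rewrite ?invgK.
rewrite (reindex_inj invg_inj) /=; apply: eq_big => [q|q _].
  by rewrite col_stabE //; apply/idP/idP => /wstabV; rewrite ?invgK.
rewrite odd_permV -!invMg -eq_invg1 invgK; congr (_ * (nat_of_bool _)%:R).
by rewrite -[RHS](inj_eq (mulgI h)) -[RHS](inj_eq (mulIg h^-1%g)) mulg1 mulgV !mulgA mulgK.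
Qed.

Let cc1 : cc 1%g = 1.
Proof.
have P1 : 1%g \in P by rewrite row_stabE //; apply/wstabP=> i; rewrite perm1.
have Q1 : 1%g \in Q by rewrite col_stabE //; apply/wstabP=> i; rewrite perm1.
rewrite coef_ab (bigD1 1%g) //= (bigD1 1%g) //= odd_perm1 !mulg1 eqxx mul1r.
rewrite big1 ?addr0 => [|q /andP[_ q1]]; last by rewrite mul1g mulg1 (negbTE q1) mulr0.
rewrite big1 ?addr0 // => p /andP[hp p1]; rewrite big1 // => q hq.
rewrite mulg1 -eq_invg_mul; case: eqP => [E|]; rewrite ?mulr0 //.
case/eqP: p1; move: hp hq; rewrite -E row_stabE // col_stabE // => /wstabP hp.
move=> /wstabV; rewrite invgK => /wstabP hq.
by apply/permP=> i; rewrite perm1; apply: (word_inj hla).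
Qed.

Let cc_real h : cc h \is Num.real.
Proof.
rewrite coef_ab; apply: rpred_sum => p _; apply: rpred_sum => q _.
by rewrite rpredM ?rpredX ?rpredN ?rpred1 ?realn.
Qed.

(** As c has coefficient 1 at the identity, this is the scalar in c c = kappa c, classically the
    product of the hook lengths. *)
Definition hook_scalar : C := coef (c *m c) 1%g.
Local Notation kappa := hook_scalar.

Let coefC (X Y : 'M[C]_N) (h : 'S_n) : coef (X *m Y) h = coef (Y *m rho h *m X) 1%g.
Proof.
by rewrite /coef rho1 mulmx1 -[in LHS]mulmxA mxtrace_mulC.
Qed.

Let c_rho_c g : exists s, c *m rho g *m c = s *: c.
Proof.
have -> : c *m rho g *m c = \sum_(q in Q) \sum_(p in P)
    (-1) ^+ q *: (a *m rho (q * g * p)%g *m b).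
  have -> : c *m rho g *m c = a *m (b *m rho g *m a) *m b by rewrite cE !mulmxA.
  have -> : b *m rho g *m a = \sum_(q in Q) \sum_(p in P) (-1) ^+ q *: rho (q * g * p)%g.
    rewrite !mulmx_suml; apply: eq_bigr => q _; rewrite mulmx_sumr; apply: eq_bigr => p _.
    by rewrite -!scalemxAl -!rhoM.
  rewrite [a *m _]mulmx_sumr [LHS]mulmx_suml; apply: eq_bigr => q _.
  rewrite [a *m _]mulmx_sumr [LHS]mulmx_suml; apply: eq_bigr => p _.
  by rewrite -scalemxAr -scalemxAl.
elim/big_ind : _ => [|X Y [s ->] [t ->]|q _]; first by exists 0; rewrite scale0r.
  by exists (s + t); rewrite scalerDl.
elim/big_ind : _ => [|X Y [s ->] [t ->]|p _]; first by exists 0; rewrite scale0r.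
  by exists (s + t); rewrite scalerDl.
by have [s ->] := sandwich (q * g * p)%g; exists ((-1) ^+ q * s); rewrite scalerA.
Qed.

(** The product is some multiple of c, and the multiple is its coefficient at the identity.
    Cyclicity of the trace turns this into a coefficient of c c = kappa c. *)
Lemma young_sandwich g : c *m rho g *m c = (kappa * cc g) *: c.
Proof.
have H x : c *m rho x *m c = coef (c *m c) x *: c.
  have [s hs] := c_rho_c x; rewrite hs; congr (_ *: _).
  have := congr1 (fun X => coef X 1%g) hs; rewrite /= coefZ cc1 mulr1 => <-.
  by rewrite [RHS]coefC.
have cck : c *m c = kappa *: c by have := H 1%g; rewrite rho1 mulmx1.
by rewrite H cck coefZ.
Qed.

Lemma young_square : c *m c = kappa *: c.
Proof. by have := young_sandwich 1%g; rewrite rho1 mulmx1 cc1 mulr1. Qed.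

(** The trace of left multiplication by c is computed twice, from c c = kappa c and from the
    coefficient 1 of c at the identity. *)
Lemma hook_scalar_rank : kappa * (\rank (left_mult c))%:R = N%:R.
Proof.
rewrite -(trace_quasi_idempotent (left_mult_square span_young young_square)).
rewrite (left_mult_trace span_young).
have := cc1; rewrite /coef rho1 mulmx1 => /(congr1 (fun x => x * N%:R)).
by rewrite mul1r divfK // natN_neq0.
Qed.

Lemma hook_scalar_neq0 : kappa != 0.
Proof.
apply/eqP => k0; have := hook_scalar_rank; rewrite k0 mul0r => /esym/eqP.
by rewrite (negbTE (natN_neq0 C _)).
Qed.

(** For the central z, the product c z c equals c c z = kappa c z on one side and is evaluated term
    by term by [young_sandwich] on the other; kappa then cancels. *)
Lemma young_central (f : 'S_n -> C) (hf : forall x y, f (x ^ y)%g = f x) :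
  c *m (\sum_g f g *: rho g) = (\sum_g f g * cc g) *: c.
Proof.
set z := \sum_g _.
have cz : c *m z = z *m c.
  rewrite [c in LHS]span_young [c in RHS]span_young mulmx_suml mulmx_sumr.
  by apply: eq_bigr => g _; rewrite -scalemxAl -scalemxAr central_comm.
have E : c *m z *m c = (kappa * \sum_g f g * cc g) *: c.
  rewrite mulmx_sumr mulmx_suml mulr_sumr scaler_suml; apply: eq_bigr => g _.
  by rewrite -scalemxAr -scalemxAl young_sandwich scalerA mulrCA.
have := E; rewrite -mulmxA -cz mulmxA young_square -scalemxAl -scalerA.
by move/(scalerI hook_scalar_neq0).
Qed.

Definition young_char (x : 'S_n) : C := kappa^-1 * \sum_g cc (x ^ g)%g.
Local Notation Y := young_char.

Lemma young_charJ x s : Y (x ^ s)%g = Y x.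
Proof.
rewrite /Y; congr (_ * _); rewrite [RHS](reindex_inj (mulgI s)) /=.
by apply: eq_bigr => g _; rewrite conjgM.
Qed.

Let orbit_central (x y : 'S_n) :
  rho y *m (\sum_g rho (x ^ g)%g) = (\sum_g rho (x ^ g)%g) *m rho y.
Proof.
rewrite mulmx_sumr mulmx_suml (reindex_inj (mulIg y)) /=; apply: eq_bigr => g _.
by rewrite -!rhoM conjgM -conjgC.
Qed.

Let sum_coef (X : 'M[C]_N) (x : 'S_n) :
  \sum_g coef X (x ^ g)%g = coef (X *m \sum_g rho (x ^ g)%g) 1%g.
Proof. by rewrite /coef rho1 mulmx1 mulmx_sumr raddf_sum mulr_suml. Qed.

(** Inversion replaces a b by b a, and against a central class sum the trace does not distinguish
    the two. *)
Lemma young_charV x : Y x^-1%g = Y x.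
Proof.
rewrite /Y; congr (_ * _).
under eq_bigr => g _ do rewrite conjVg coef_inv.
rewrite !sum_coef cE; set Z := \sum_g _.
rewrite /coef rho1 !mulmx1 -mulmxA mxtrace_mulC; congr (\tr _ / _).
rewrite -!mulmxA; congr (a *m _).
rewrite [b *m Z]mulmx_suml [Z *m b]mulmx_sumr.
by apply: eq_bigr => q _; rewrite -scalemxAl -scalemxAr orbit_central.
Qed.

Lemma young_char_real x : Y x \is Num.real.
Proof.
have kr : kappa \is Num.real.
  have -> : kappa = N%:R / (\rank (left_mult c))%:R.
    have h := hook_scalar_rank; have r0 : (\rank (left_mult c))%:R != 0 :> C.
      by apply: contraTneq (natN_neq0 C 'S_n) => r0; rewrite -h r0 mulr0 eqxx.
    by rewrite -h mulfK.
  by rewrite rpred_div ?realn.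
by rewrite rpredM ?rpredV //; apply: rpred_sum => g _.
Qed.

Let sum_span (X : 'M[C]_N) : in_span X -> forall Z : 'M[C]_N,
  \sum_g coef X g^-1%g * coef Z g = coef (Z *m X) 1%g.
Proof.
move=> hX Z; rewrite [X in RHS]hX mulmx_sumr coef_sum; apply: eq_bigr => g _.
by rewrite -scalemxAr coefZ; congr (_ * _); rewrite /coef rho1 mulmx1.
Qed.

(** Taking one factor at the inverse makes the sum a convolution. [young_sandwich] collapses the
    inner sum to kappa times a product of coefficients at g and its inverse, and summing these over
    g gives the identity coefficient kappa of c c. *)
Lemma young_char_norm : \sum_x Y x * Y x = N%:R.
Proof.
have k0 := hook_scalar_neq0.
have T g : \sum_x cc x * cc (x^-1 ^ g)%g = kappa * (cc g^-1%g * cc g).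
  rewrite (reindex_inj invg_inj) /=.
  rewrite (eq_bigr (fun x => cc x^-1%g * coef (rho g *m c *m rho g^-1%g) x)) => [|x _].
    rewrite (sum_span span_young).
    have -> : rho g *m c *m rho g^-1%g *m c = rho g *m (c *m rho g^-1%g *m c).
      by rewrite !mulmxA.
    rewrite young_sandwich -scalemxAr coefZ mulrA; congr (_ * _).
    by rewrite /coef rho1 mulmx1 mxtrace_mulC.
  have E : rho g *m c *m rho g^-1%g *m rho x = rho g *m (c *m rho g^-1%g *m rho x).
    by rewrite !mulmxA.
  have E2 : c *m rho g^-1%g *m rho x *m rho g = c *m (rho g^-1%g *m (rho x *m rho g)).
    by rewrite !mulmxA.
  by rewrite invgK conjgE /coef !rhoM -E2 E [in X in _ = _ * X]mxtrace_mulC.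
have E x : Y x * Y x = \sum_g kappa^-1 * (cc (x ^ g)%g * Y (x ^ g)^-1%g).
  rewrite {1}/Y -mulrA mulr_suml mulr_sumr; apply: eq_bigr => g _.
  by rewrite young_charV young_charJ.
rewrite (eq_bigr _ (fun x _ => E x)) exchange_big /=.
rewrite (eq_bigr (fun=> kappa^-1 * \sum_x cc x * Y x^-1%g)) => [|g _]; last first.
  rewrite -mulr_sumr; congr (_ * _).
  by rewrite [RHS](reindex_inj (conjg_inj g)).
rewrite sumr_const -cardsT -[LHS]mulr_natl -[RHS]mulr1; congr (_ * _).
have -> : \sum_x cc x * Y x^-1%g = kappa^-1 * \sum_g \sum_x cc x * cc (x^-1 ^ g)%g.
  rewrite exchange_big mulr_sumr; apply: eq_bigr => x _.
  by rewrite /Y mulrCA mulr_sumr.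
rewrite (eq_bigr _ (fun g _ => T g)) -mulr_sumr (sum_span span_young).
by rewrite -/kappa mulKf // mulVf.
Qed.

Let young_char_stab (w : {ffun 'I_n -> 'I_L}) :
  \sum_(x in wstab w) Y x =
  kappa^-1 * \sum_g coef (c *m \sum_(y in wstab (wact w g^-1%g)) rho y) 1%g.
Proof.
rewrite -mulr_sumr exchange_big /=; congr (_ * _); apply: eq_bigr => g _.
rewrite mulmx_sumr coef_sum [RHS](reindex_inj (conjg_inj g)) /=.
apply: eq_big => [x|x _]; first by rewrite wstabJ conjgK.
by rewrite /coef rho1 mulmx1.
Qed.

(** Without a transverse rearrangement, each conjugate stabilizer contains a transposition of the
    column group, and b annihilates the sum over that stabilizer. *)
Lemma young_char_off (w : {ffun 'I_n -> 'I_L}) :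
  (forall g, ~~ transverse la (wact w g)) -> \sum_(x in wstab w) Y x = 0.
Proof.
move=> hw; rewrite young_char_stab big1 ?mulr0 // => g _.
have [i [j [ij h1 h2]]] := transversePn (hw g^-1%g).
set A := \sum_(y in _) _.
have hA : rho (tperm i j) *m A = A by apply: stab_sum; apply: wstab_tperm.
have hb : b *m A = 0.
  apply: eq_opp0; rewrite -{1}hA mulmxA mul_col; last first.
    by rewrite col_stabE // wstab_tperm.
  by rewrite odd_tperm ij expr1 scaleN1r mulNmx.
by rewrite cE -mulmxA hb mulmx0 /coef mul0mx mxtrace0 mul0r.
Qed.

(** The row group sum a turns each term into a coefficient of c g a, a multiple of a b a. The total
    is the identity coefficient of a b a c = |P| c c, with P the row group, because a a = |P| a. *)
Lemma young_char_diag : \sum_(x in wstab rw) Y x = #|wstab rw|%:R.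
Proof.
have k0 := hook_scalar_neq0.
have c0 : c != 0.
  apply: contraNneq (oner_neq0 C) => c0.
  by rewrite -cc1 c0 /coef mul0mx mxtrace0 mul0r.
have aa : a *m a = #|wstab rw|%:R *: a.
  rewrite {1}a_stab mulmx_suml (eq_bigr (fun=> a)) ?sumr_const ?scaler_nat // => p hp.
  by rewrite row_mul // row_stabE.
have cga g : c *m rho g *m a = cc g *: (a *m b *m a).
  have [s hs] := sandwich' g.
  have E : c *m rho g *m a = s *: (a *m b *m a).
    by rewrite cE -!mulmxA [b *m _]mulmxA hs -scalemxAr.
  (* Multiplying by b on the right turns a b a into c c, so [young_sandwich] identifies the
     scalar. *)
  rewrite E; congr (_ *: _); have := young_sandwich g.
  have -> : c *m rho g *m c = (s * kappa) *: c.
    transitivity (c *m rho g *m a *m b); first by rewrite cE !mulmxA.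
    rewrite E -scalemxAl; transitivity (s *: (c *m c)); first by rewrite cE !mulmxA.
    by rewrite young_square scalerA.
  move=> /eqP.
  rewrite -subr_eq0 -scalerBl scaler_eq0 (negbTE c0) orbF subr_eq0 mulrC.
  by move=> /eqP/(mulfI k0).
rewrite -mulr_sumr exchange_big /=.
rewrite (eq_bigr (fun g => cc g^-1%g * coef (a *m b *m a) g)) => [|g _].
  have E : a *m b *m a *m c = #|wstab rw|%:R *: (c *m c).
    have -> : a *m b *m a *m c = a *m b *m (a *m a) *m b by rewrite cE !mulmxA.
    by rewrite aa -scalemxAr -scalemxAl cE !mulmxA.
  rewrite (sum_span span_young) E young_square !coefZ cc1 mulr1.
  by rewrite mulrCA mulVf ?mulr1.
rewrite -coefZ -cga a_stab mulmx_sumr coef_sum; apply: eq_bigr => x _.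
by rewrite /coef conjgE !rhoM !mulmxA.
Qed.
End YoungSymmetrizer.

(** * The Frobenius characteristic *)

Section CycleConjugation.
Variable n : nat.
Implicit Types (x s : 'S_n).

Lemma porbit_conjg x s i : porbit (x ^ s)%g (s i) = s @: porbit x i.
Proof.
apply/setP=> j; apply/porbitP/imsetP => [[m ->]|[_ /porbitP[m ->] ->]].
  by exists ((x ^+ m)%g i); rewrite ?mem_porbit // -conjXg permJ.
by exists m; rewrite -conjXg permJ.
Qed.

Lemma porbits_conjg x s : porbits (x ^ s)%g = [set s @: A | A : {set 'I_n} in porbits x].
Proof.
apply/setP=> A; apply/imsetP/imsetP => [[i _ ->]|[_ /imsetP[i _ ->] ->]].
  exists (porbit x (s^-1 i)%g); first exact: imset_f.
  by rewrite -porbit_conjg permKV.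
by exists (s i); rewrite ?porbit_conjg.
Qed.

Lemma alpha_conjg x s : alpha (x ^ s)%g = alpha x.
Proof.
by rewrite /alpha porbits_conjg card_imset //; apply: imset_inj; apply: perm_inj.
Qed.

Lemma alphak_conjg k x s : alphak k (x ^ s)%g = alphak k x.
Proof.
have inj : injective (fun A : {set 'I_n} => s @: A).
  by apply: imset_inj; apply: perm_inj.
rewrite /alphak porbits_conjg -[RHS](card_imset _ inj); apply: eq_card => A.
rewrite inE; apply/andP/imsetP.
  move=> [/imsetP[B hB ->]]; rewrite card_imset; last exact: perm_inj.
  by exists B; rewrite // inE hB.
move=> [B]; rewrite inE => /andP[hB hk] ->; split; first exact: imset_f.
by rewrite card_imset //; apply: perm_inj.
Qed.
End CycleConjugation.

(** * Cycle polynomials and words with two coordinates *)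

Section FrobeniusCharacteristic.
Variables (R : numFieldType) (n : nat).
Local Notation L := n.+1.
Local Notation MB := 'X_{1..L < L}.
Local Notation hsym := (@hsym R n).

Definition weight (w : {ffun 'I_n -> 'I_L}) : 'X_{1..L} := [multinom content w t | t < L].

(* The power sum polynomial attached to the cycle type of [x]. *)
Definition cycle_poly (x : 'S_n) : {mpoly R[L]} :=
  \sum_(w : {ffun 'I_n -> 'I_L} | x \in wstab w) 'X_[weight w].

Lemma sum_content (T : finType) (w : {ffun 'I_n -> T}) : (\sum_t content w t = n)%N.
Proof.
rewrite -[RHS]card_ord -sum1_card (partition_big w predT) //=.
by apply: eq_bigr => t _; rewrite /content -sum1_card; apply: eq_bigl => i; rewrite inE.
Qed.

Section PairWords.
Variable T : finType.
Implicit Types (z : {ffun 'I_n -> 'I_L * T}) (K : {ffun T -> MB}).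

Lemma pair_weight_bound z c : (mdeg [multinom content z (t, c) | t < L] < L)%N.
Proof.
rewrite ltnS mdegE -[X in (_ <= X)%N](sum_content z).
rewrite -(pair_bigA _ (fun t c => content z (t, c))) /=; apply: leq_sum => t _.
by rewrite mnmE (bigD1 c) //= leq_addr.
Qed.

(** The contents of z split by second letter, one exponent for each c in [T]. Bounding the degrees
    makes these families a finite type to sum over. *)
Definition pair_weight z : {ffun T -> MB} :=
  [ffun c => BMultinom (pair_weight_bound z c)].

Lemma pair_weightE z c t : pair_weight z c t = content z (t, c).
Proof. by rewrite ffunE mnmE. Qed.

Lemma pair_weight_eq z z' :
  (pair_weight z == pair_weight z') = [forall t, content z t == content z' t].
Proof.
apply/eqP/forallP => [h [t c]|h].
  by rewrite -!pair_weightE h.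
apply/ffunP=> c; apply/val_inj/mnmP => /= t.
by rewrite !pair_weightE; apply/eqP/h.
Qed.

Lemma mdeg_pair_weight z : (\sum_c mdeg (pair_weight z c) = n)%N.
Proof.
rewrite -[RHS](sum_content z) -(pair_bigA _ (fun t c => content z (t, c))) /=.
rewrite exchange_big; apply: eq_bigr => c _; rewrite mdegE; apply: eq_bigr => t _.
by rewrite pair_weightE.
Qed.

Lemma pair_weight_surj K : (\sum_c mdeg (K c) = n)%N -> exists z, pair_weight z = K.
Proof.
move=> hK; have [|z hz] := @content_exists n _ (fun p : 'I_L * T => K p.2 p.1).
  rewrite -(pair_bigA _ (fun t c => K c t)) exchange_big -[RHS]hK.
  by apply: eq_bigr => c _; rewrite mdegE.
exists z; apply/ffunP=> c; apply/val_inj/mnmP => /= t.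
by rewrite pair_weightE hz.
Qed.

Lemma content_fst z t : content [ffun i => (z i).1] t = (\sum_c pair_weight z c t)%N.
Proof.
rewrite /content -sum1_card (partition_big (fun i => (z i).2) predT) //=.
apply: eq_bigr => c _; rewrite pair_weightE /content -sum1_card; apply: eq_bigl => i.
by rewrite !inE ffunE -pair_eqE.
Qed.

Lemma content_snd z c : content [ffun i => (z i).2] c = mdeg (pair_weight z c).
Proof.
rewrite mdegE /content -sum1_card (partition_big (fun i => (z i).1) predT) //=.
apply: eq_bigr => t _; rewrite pair_weightE /content -sum1_card; apply: eq_bigl => i.
by rewrite !inE ffunE -pair_eqE /= andbC.
Qed.

Lemma weight_fst z : weight [ffun i => (z i).1] = (\sum_c (pair_weight z c : 'X_{1..L}))%MM.
Proof. by apply/mnmP=> t; rewrite mnmE content_fst mnm_sumE. Qed.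

Lemma sum_pair_words (V : nmodType) (F : {ffun 'I_n -> 'I_L} -> {ffun 'I_n -> T} -> V) :
  \sum_w \sum_w' F w w' =
  \sum_(z : {ffun 'I_n -> 'I_L * T}) F [ffun i => (z i).1] [ffun i => (z i).2].
Proof.
rewrite pair_bigA /=.
pose h (z : {ffun 'I_n -> 'I_L * T}) :=
  ([ffun i => (z i).1] : {ffun 'I_n -> 'I_L}, [ffun i => (z i).2] : {ffun 'I_n -> T}).
pose g (p : {ffun 'I_n -> 'I_L} * {ffun 'I_n -> T}) : {ffun 'I_n -> 'I_L * T} :=
  [ffun i => (p.1 i, p.2 i)].
rewrite (reindex h) //=; exists g => [z _|[w w'] _].
  by apply/ffunP=> i; rewrite !ffunE; case: (z i).
by congr pair; apply/ffunP=> i; rewrite !ffunE.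
Qed.

Lemma wstab_pair z x :
  (x \in wstab z) = (x \in wstab [ffun i => (z i).1]) && (x \in wstab [ffun i => (z i).2]).
Proof.
apply/wstabP/andP => [h|[/wstabP h1 /wstabP h2] i].
  by split; apply/wstabP=> i; rewrite !ffunE h.
have := h1 i; have := h2 i; rewrite !ffunE => e2 e1.
by rewrite [z (x i)]surjective_pairing e1 e2 -surjective_pairing.
Qed.

(** The double count behind both characteristics: the sums over x and over its fixed words are
    exchanged, words are grouped by content, and [orbit_sum] treats each group. [avg K] is the mean
    of F on the stabilizer of a word of content K. *)
Lemma sum_by_pair_weight (A : lmodType R) (F : 'S_n -> R) (G : {ffun T -> MB} -> A)
    (D : pred {ffun T -> MB}) (avg : {ffun T -> MB} -> R) :
    (forall x s, F (x ^ s)%g = F x) ->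
    (forall z, \sum_(x in wstab z) F x = #|wstab z|%:R * avg (pair_weight z)) ->
    (forall K, D K -> \sum_c mdeg (K c) = n)%N ->
  \sum_x F x *: (\sum_(z | (x \in wstab z) && D (pair_weight z)) G (pair_weight z))
  = n`!%:R *: \sum_(K | D K) avg K *: G K.
Proof.
move=> hF havg hD.
transitivity (\sum_(z | D (pair_weight z)) (\sum_(x in wstab z) F x) *: G (pair_weight z)).
  under eq_bigr => x _ do rewrite scaler_sumr big_mkcondl.
  rewrite exchange_big big_mkcond [RHS]big_mkcond; apply: eq_bigr => z _.
  by case: ifP => // _; rewrite scaler_suml [RHS]big_mkcond.
rewrite (partition_big pair_weight D) //= scaler_sumr; apply: eq_bigr => K DK.
have [z0 hz0] := pair_weight_surj (hD K DK).
rewrite (eq_bigr (fun z => (\sum_(x in wstab z) F x) *: G K)); last first.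
  by move=> z /andP[_ /eqP ->].
rewrite -scaler_suml scalerA; congr (_ *: _).
have s0 : (#|wstab z0|%:R : R) != 0 by rewrite pnatr_eq0 -lt0n card_wstab_gt0.
apply: (mulIf s0); rewrite mulr_natr.
rewrite (eq_bigl (fun z => [forall t, content z t == content z0 t])).
  rewrite (orbit_sum z0 hF) havg hz0 -[LHS]mulr_natl -mulrA; congr (_ * _); exact: mulrC.
move=> z; rewrite -pair_weight_eq hz0; case: eqP => [->|]; rewrite ?andbF ?andbT ?DK //.
Qed.
End PairWords.

Lemma mcoeff_cycle_poly x nu :
  (cycle_poly x)@_nu = \sum_(w | x \in wstab w) (weight w == nu)%:R.
Proof. by rewrite raddf_sum; apply: eq_bigr => w _; rewrite /= mcoeffX. Qed.

(** The coefficient at nu counts the words of weight nu fixed by x, a permutation character. Paired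
    with the words of [cycle_poly] these are words on pairs of letters, and a product of
    [hsym (nu c)] chooses one monomial for each second letter. *)
Lemma frobenius_permutation nu : mdeg nu = n ->
  \sum_x (cycle_poly x)@_nu *: cycle_poly x = n`!%:R *: \prod_c hsym (nu c).
Proof.
move=> dnu.
pose D (K : {ffun 'I_L -> MB}) := K \in family (fun c v => mdeg (v : MB) == nu c).
have DP (K : {ffun 'I_L -> MB}) : reflect (forall c, mdeg (K c) = nu c) (D K).
  apply: (iffP familyP) => h c; first by have /eqP := h c.
  by apply/eqP/h.
have -> : \prod_c hsym (nu c) = \sum_(K | D K) (1 : R) *: \prod_c 'X_[K c].
  rewrite bigA_distr_big_dep /=; apply: eq_bigr => K _; by rewrite scale1r.
rewrite -(@sum_by_pair_weight _ _ (fun=> 1)) //; last 2 first.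
- by move=> z; rewrite sumr_const mulr1.
- move=> K /DP hK; rewrite -[RHS]dnu mdegE; exact: eq_bigr.
apply: eq_bigr => x _; rewrite scale1r mcoeff_cycle_poly scaler_suml.
under eq_bigr => w' _ do rewrite /cycle_poly scaler_sumr.
rewrite exchange_big /= [LHS]big_mkcond /=.
under eq_bigr => w _ do rewrite big_mkcond /=.
transitivity (\sum_w \sum_(w' : {ffun 'I_n -> 'I_L})
    if (x \in wstab w) && (x \in wstab w') && (weight w' == nu)
    then 'X_[weight w] : {mpoly R[L]} else 0).
  apply: eq_bigr => w _; case: ifP => _ /=; last by rewrite big1.
  by apply: eq_bigr => w' _; case: ifP => //= _; case: eqP; rewrite ?scale1r ?scale0r.
rewrite (@sum_pair_words 'I_L _ (fun w w' =>
  if (x \in wstab w) && (x \in wstab w') && (weight w' == nu) then 'X_[weight w] else 0)).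
rewrite [RHS]big_mkcond; apply: eq_bigr => z _; rewrite -wstab_pair weight_fst -mprodXE.
congr (if _ then _ else _); congr andb; apply/eqP/DP => [/mnmP h c|h].
  by rewrite -(h c) mnmE content_snd.
by apply/mnmP=> c; rewrite mnmE content_snd h.
Qed.
End FrobeniusCharacteristic.

(** * The characteristic of the cycle weight *)

Section CycleCharacteristic.
Variables (R : numFieldType) (n k : nat).
Hypothesis hk : (0 < k <= n)%N.
Local Notation L := n.+1.
Local Notation MB := 'X_{1..L < L}.
Local Notation hsym := (@hsym R n).

Lemma sum_shift_monomials (t : 'I_L) (g : nat -> {mpoly R[L]}) :
  \sum_(v : MB | (k <= (v : 'X_{1..L}) t)%N) 'X_[v] * g (mdeg v) =
  'X_[U_(t) *+ k] * \sum_(a < (n - k).+1) hsym a * g (a + k)%N.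
Proof.
have [k0 kn] := andP hk.
have -> : \sum_(a < (n - k).+1) hsym a * g (a + k)%N =
    \sum_(v : MB | (mdeg v <= n - k)%N) 'X_[v] * g (mdeg v + k)%N.
  rewrite (partition_big (fun v : MB => inord (mdeg v) : 'I_(n - k).+1) predT) //=.
  apply: eq_bigr => a _; rewrite mulr_suml; apply: eq_big => [v|v /eqP -> //].
  have := ltn_ord a; rewrite ltnS => ak; apply/eqP/andP => [va|[vk /eqP <-]].
    by rewrite va ak; split=> //; apply/eqP/val_inj; rewrite /= inordK ?va.
  by rewrite inordK.
rewrite mulr_sumr.
have z0 : (mdeg (0%MM : 'X_{1..L}) < L)%N by rewrite mdeg0.
(* Beyond the degree bound h falls back to 0, whose exponent at t is below k > 0, so the summation
   condition rejects these v. *)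
pose h (v : MB) : MB := insubd (BMultinom z0) (v + U_(t) *+ k)%MM.
pose h' (v : MB) : MB := insubd v (v - U_(t) *+ k)%MM.
have hE (v : MB) : (mdeg v <= n - k)%N -> h v = (v + U_(t) *+ k)%MM :> 'X_{1..L}.
  by move=> vk; rewrite /h val_insubd mdegD mdegMn mdeg1 mul1n; case: ifP => //; lia.
have h'E (v : MB) : h' v = (v - U_(t) *+ k)%MM :> 'X_{1..L}.
  by rewrite /h' val_insubd (leq_ltn_trans (mdegB _ _) (bmdeg v)).
have le (m : 'X_{1..L}) : (k <= m t)%N -> (U_(t) *+ k <= m)%MM.
  move=> km; apply/mnm_lepP=> i; rewrite mulmnE mnm1E.
  by case: eqP => [<-|_]; rewrite ?mul1n ?mul0n.
rewrite (reindex_onto h h') /= => [|v kv]; last first.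
  have d := mdegD (v - U_(t) *+ k)%MM (U_(t) *+ k)%MM.
  rewrite submK ?le // mdegMn mdeg1 mul1n in d.
  apply/val_inj; rewrite /= hE h'E ?submK ?le //.
  by have := bmdeg v; rewrite d; lia.
apply: eq_big => [v|v].
  have [vk|nvk] := leqP (mdeg v) (n - k).
    rewrite hE // mnmDE mulmnE mnm1E eqxx mul1n leq_addl /=.
    by apply/eqP/val_inj; rewrite /= h'E hE // addmK.
  rewrite /h val_insubd mdegD mdegMn mdeg1 mul1n ifF; last lia.
  by rewrite /= mnm0E leqNgt k0.
move=> /andP[hkv hh]; have vk : (mdeg v <= n - k)%N.
  rewrite leqNgt; apply: contraTN hkv => nvk.
  rewrite /h val_insubd mdegD mdegMn mdeg1 mul1n ifF; last lia.
  by rewrite /= mnm0E -ltnNge.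
by rewrite hE // mdegD mdegMn mdeg1 mul1n mpolyXD mulrCA mulrA.
Qed.

Lemma sum_pair_monomials (c : bool) (t : 'I_L) :
  \sum_(K : {ffun bool -> MB} |
      (\sum_d mdeg (K d) == n)%N && (k <= (K c : 'X_{1..L}) t)%N) \prod_d 'X_[K d] =
  'X_[U_(t) *+ k] * \sum_(a < (n - k).+1) hsym a * hsym (n - k - a)%N.
Proof.
pose h (p : MB * MB) : {ffun bool -> MB} := [ffun d => if d == c then p.1 else p.2].
pose h' (K : {ffun bool -> MB}) := (K c, K (~~ c)).
rewrite (reindex h) /=; last first.
  exists h' => [[v1 v2] _|K _].
    by rewrite /h' /h !ffunE eqxx (_ : (~~ c == c) = false) //; case: (c).
  apply/ffunP=> d; rewrite ffunE /h' /=; case: eqVneq => [-> //|].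
  by move: d; case: (c) => -[].
transitivity (\sum_(v1 : MB | (k <= (v1 : 'X_{1..L}) t)%N) 'X_[v1] * hsym (n - mdeg v1)%N).
  rewrite big_mkcond -(pair_bigA _ (fun v1 v2 => if (\sum_d mdeg (h (v1, v2) d) == n)%N &&
     (k <= (h (v1, v2) c : 'X_{1..L}) t)%N then \prod_d 'X_[h (v1, v2) d] else 0)) /=.
  rewrite [RHS]big_mkcond; apply: eq_bigr => v1 _.
  rewrite mulr_sumr [in RHS]big_mkcond.
  have hc v2 : h (v1, v2) c = v1 by rewrite ffunE eqxx.
  case: ifP => kv1; last by rewrite big1 // => v2 _; rewrite hc kv1 andbF.
  apply: eq_bigr => v2 _; rewrite hc kv1 andbT !big_bool /h !ffunE.
  have := bmdeg v1; rewrite ltnS => b1.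
  have -> : (mdeg v2 == n - mdeg v1)%N = (mdeg v1 + mdeg v2 == n)%N by lia.
  by case: (c); rewrite /= ?[(mdeg v2 + _)%N]addnC //; case: ifP => // _; rewrite mulrC.
rewrite (sum_shift_monomials t (fun m => hsym (n - m)%N)); congr (_ * _).
by apply: eq_bigr => a _; rewrite addnC subnDA.
Qed.

(** With [2 ^ alpha x] read as a number of two-letter words, x acts on words with letters (t, c), c
    a boolean. By [sum_alphak_wstab] the mean of [alphak k] on a stabilizer is 1/k times the number
    of letters of multiplicity at least k. Such a letter splits off x_t^k, and both values of c give
    the same sum. *)
Lemma frobenius_cycles :
  \sum_x (alphak k x * 2 ^ alpha x)%N%:R *: cycle_poly R x =
  (n`!%:R * (2 / k%:R)) *: \sum_(t : 'I_L)
    ('X_[U_(t) *+ k] * \sum_(a < (n - k).+1) hsym a * hsym (n - k - a)%N).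
Proof.
have [k0 kn] := andP hk.
have kR : (k%:R : R) != 0 by rewrite pnatr_eq0 -lt0n.
pose D (K : {ffun bool -> MB}) := (\sum_d mdeg (K d) == n)%N.
pose avg (K : {ffun bool -> MB}) : R :=
  k%:R^-1 * \sum_(c : bool) \sum_(t : 'I_L) (k <= (K c : 'X_{1..L}) t)%N%:R.
transitivity (\sum_(x : 'S_n) (alphak k x)%:R *: \sum_(z : {ffun 'I_n -> 'I_L * bool} |
    (x \in wstab z) && D (pair_weight z)) \prod_d 'X_[pair_weight z d] : {mpoly R[L]}).
  apply: eq_bigr => x _; rewrite natrM -scalerA; congr (_ *: _).
  rewrite -card_fixed_bool_words scaler_nat -sumr_const /cycle_poly.
  rewrite (eq_bigl (fun w => x \in wstab w)); last by move=> w; rewrite inE.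
  rewrite exchange_big /= big_mkcond /=.
  under eq_bigr => w _ do rewrite big_mkcond /=.
  transitivity (\sum_w \sum_(w' : {ffun 'I_n -> bool})
      if (x \in wstab w) && (x \in wstab w') then 'X_[weight w] : {mpoly R[L]} else 0).
    by apply: eq_bigr => w _; case: ifP => _ //; rewrite big1.
  rewrite (@sum_pair_words _ bool _ (fun w w' =>
    if (x \in wstab w) && (x \in wstab w') then 'X_[weight w] else 0)).
  rewrite [RHS]big_mkcond; apply: eq_bigr => z _.
  by rewrite -wstab_pair weight_fst -mprodXE /D mdeg_pair_weight eqxx andbT.
rewrite (@sum_by_pair_weight _ _ _ _ (fun x => (alphak k x)%:R) (fun K => \prod_d 'X_[K d])
   D avg); last 3 first.
- by move=> x s; rewrite alphak_conjg.
- move=> z; apply: (mulfI kR); rewrite mulrCA /avg mulVKf //.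
  rewrite -natr_sum -natrM sum_alphak_wstab // natrM; congr (_ * _).
  transitivity (\sum_(p : 'I_L * bool) (k <= content z (p.1, p.2))%N%:R : R).
    rewrite -sum1_card big_mkcond natr_sum /=; apply: eq_bigr => -[t c] _.
    by rewrite inE; case: leqP.
  rewrite -(pair_bigA _ (fun t c => (k <= content z (t, c))%N%:R)) exchange_big /=.
  by apply: eq_bigr => c _; apply: eq_bigr => t _; rewrite pair_weightE.
- by move=> K /eqP.
rewrite -scalerA; congr (_ *: _).
transitivity (k%:R^-1 *: \sum_(c : bool) \sum_(t : 'I_L)
   ('X_[U_(t) *+ k] * \sum_(a < (n - k).+1) hsym a * hsym (n - k - a)%N)).
  rewrite scaler_sumr; under [RHS]eq_bigr => c _ do rewrite scaler_sumr.
  under [RHS]eq_bigr => c _ do under eq_bigr => t _ do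
    rewrite -(sum_pair_monomials c t) scaler_sumr big_mkcondr.
  have E K : avg K *: \prod_d 'X_[K d] = \sum_(c : bool) \sum_(t : 'I_L)
      (if (k <= (K c : 'X_{1..L}) t)%N then k%:R^-1 *: \prod_d 'X_[K d] else 0)
      :> {mpoly R[L]}.
    rewrite /avg mulr_sumr scaler_suml; apply: eq_bigr => c _.
    rewrite mulr_sumr scaler_suml; apply: eq_bigr => t _.
    by case: ifP; rewrite ?mulr1 // mulr0 scale0r.
  rewrite (eq_bigr _ (fun K _ => E K)) exchange_big; apply: eq_bigr => c _.
  by rewrite exchange_big.
by rewrite big_bool /= -mulr2n -scaler_nat scalerA mulrC.
Qed.
End CycleCharacteristic.

(** * Frobenius character formula *)

Section FrobeniusFormula.
Variables (C : numClosedFieldType) (n : nat) (la : seq nat).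
Hypothesis hla : is_partition n la.
Local Notation L := n.+1.
Local Notation "m # s" := [multinom m (s i) | i < L]
  (at level 40, left associativity, format "m # s").
Local Notation lam := (shape_mnm n la).
Local Notation u := (delta n + shape_mnm n la)%MM.
Local Notation Y := (@young_char C n la).
Local Notation W := (cycle_poly C).
Local Notation Delta := (alternant C (delta n)).

Definition frobenius_char (x : 'S_n) : C := (Delta * W x)@_u.
Local Notation psi := frobenius_char.

Let lam_decr (i k : 'I_L) : (i <= k)%N -> (lam k <= lam i)%N.
Proof. by move=> ik; rewrite !mnmE; have [h _ _ _ _] := partition_facts hla; apply: h. Qed.

Let mdeg_lam : mdeg lam = n.
Proof.
rewrite mdegE; have [_ _ _ _ h] := partition_facts hla.
by rewrite -[RHS]h; apply: eq_bigr => i _; rewrite mnmE.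
Qed.

Lemma mcoeffXM m (p : {mpoly C[L]}) v :
  ('X_[m] * p)@_v = if (m <= v)%MM then p@_(v - m) else 0.
Proof.
case: ifP => h; first by rewrite mulrC -{1}(submK h) addmC mcoeffMX.
rewrite mcoeffM_sub big1 // => w wv; rewrite mcoeffX.
by case: eqP => [mw|]; rewrite ?mul0r //; move: h; rewrite mw wv.
Qed.

Lemma frobenius_pairing (F : 'S_n -> C) :
  \sum_x F x * psi x = \sum_(s : 'S_L) (-1) ^+ s *
    (if (delta n # s <= u)%MM then \sum_x F x * (W x)@_(u - delta n # s) else 0).
Proof.
have E x : F x * psi x = \sum_(s : 'S_L) (-1) ^+ s *
    (if (delta n # s <= u)%MM then F x * (W x)@_(u - delta n # s) else 0).
  rewrite /psi mulr_suml raddf_sum mulr_sumr; apply: eq_bigr => s _ /=.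
  rewrite -scalerAl mcoeffZ mcoeffXM mulrCA; congr (_ * _).
  by case: ifP; rewrite ?mulr0.
rewrite (eq_bigr _ (fun x _ => E x)) exchange_big; apply: eq_bigr => s _ /=.
by rewrite -mulr_sumr; congr (_ * _); case: ifP => // _; rewrite big1.
Qed.

Lemma frobenius_pairing_one (F : 'S_n -> C) (c : C) :
    (forall s : 'S_L, s != 1%g -> (delta n # s <= u)%MM ->
       \sum_x F x * (W x)@_(u - delta n # s) = 0) ->
    \sum_x F x * (W x)@_lam = c ->
  \sum_x F x * psi x = c.
Proof.
move=> h0 h1; rewrite frobenius_pairing (bigD1 1%g) //= mperm1 odd_perm1 expr0 mul1r.
rewrite lem_addr [(delta n + _)%MM]addmC addmK h1 big1 ?addr0 // => s s1.
case: ifP => hs; last by rewrite mulr0.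
by rewrite [(shape_mnm n la + _)%MM]addmC h0 ?mulr0 // addmC.
Qed.

Let deg_shift (s : 'S_L) : (delta n # s <= u)%MM -> mdeg (u - delta n # s)%MM = n.
Proof.
move=> hs; have := mdegD (u - delta n # s)%MM (delta n # s).
by rewrite submK // mdeg_mperm mdegD mdeg_lam; lia.
Qed.

Lemma frobenius_char_norm : \sum_x psi x * psi x = n`!%:R.
Proof.
have key nu : mdeg nu = n -> \sum_x psi x * (W x)@_nu =
    n`!%:R * (Delta * \prod_c hsym C n (nu c))@_u.
  move=> dnu; rewrite -mcoeffZ scalerAr -frobenius_permutation // mulr_sumr raddf_sum.
  by apply: eq_bigr => x _; rewrite /= -scalerAr mcoeffZ mulrC.
apply: frobenius_pairing_one => [s s1 hs|].
  by rewrite key ?deg_shift // kostka_off ?mulr0.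
by rewrite key // kostka_diag ?mulr1.
Qed.

Let weight_eq (w : {ffun 'I_n -> 'I_L}) nu :
  (weight w == nu) = [forall t, content w t == nu t].
Proof.
apply/eqP/forallP => [<- t|h]; first by rewrite mnmE.
by apply/mnmP=> t; rewrite mnmE; apply/eqP/h.
Qed.

Let pairing_words nu :
  \sum_x Y x * (W x)@_nu = \sum_(w | weight w == nu) \sum_(x in wstab w) Y x.
Proof.
under eq_bigr => x _ do rewrite mcoeff_cycle_poly mulr_sumr big_mkcond /=.
rewrite exchange_big [RHS]big_mkcond /=; apply: eq_bigr => w _.
case: eqP => _; last by rewrite big1 // => x _; case: ifP; rewrite ?mulr0.
by rewrite [RHS]big_mkcond; apply: eq_bigr => x _; rewrite mulr1.
Qed.

Lemma young_frobenius_pairing : \sum_x Y x * psi x = n`!%:R.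
Proof.
apply: frobenius_pairing_one => [s s1 hs|]; rewrite pairing_words.
  (* A transverse rearrangement would make the content of w dominated by la, which [perm_dominated]
     allows only for s = 1. *)
  apply: big1 => w /eqP hw; apply: young_char_off => // g.
  apply: contra s1 => htr; apply/eqP/(perm_dominated hs) => t _.
  rewrite -hw; have := transverse_dominance hla t htr.
  rewrite /psum; congr (_ <= _)%N; apply: eq_bigr => i _.
    by rewrite content_wact mnmE.
  by rewrite mnmE.
set rw := row_word n la.
have s0 : (#|wstab rw|%:R : C) != 0 by rewrite pnatr_eq0 -lt0n card_wstab_gt0.
apply: (mulIf s0); rewrite mulr_natr.
rewrite (eq_bigl (fun w => [forall t, content w t == content rw t])).
  rewrite (orbit_sum rw (young_charJ C la)) young_char_diag //.
  by rewrite -[LHS]mulr_natl.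
move=> w; rewrite weight_eq; apply: eq_forallb => t.
by rewrite content_row_word // mnmE.
Qed.

Lemma frobenius_char_real x : psi x \is Num.real.
Proof.
rewrite /psi mulr_suml raddf_sum; apply: rpred_sum => s _ /=.
rewrite -scalerAl mcoeffZ mcoeffXM rpredM ?rpredX ?rpredN ?rpred1 //.
case: ifP => _; last exact: rpred0.
by rewrite mcoeff_cycle_poly; apply: rpred_sum => w _; rewrite realn.
Qed.

(* Both class functions have norm 1 and inner product 1. *)
Lemma frobenius_formula x : Y x = psi x.
Proof.
have E : \sum_x (Y x - psi x) ^+ 2 = 0.
  have -> : \sum_x (Y x - psi x) ^+ 2 =
      \sum_x Y x * Y x - 2 * (\sum_x Y x * psi x) + \sum_x psi x * psi x.
    rewrite mulr_sumr -sumrB -big_split; apply: eq_bigr => y _ /=.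
    by rewrite sqrrB expr2 mulr_natl expr2.
  rewrite young_char_norm // young_frobenius_pairing frobenius_char_norm.
  rewrite cardsT -card_Sn; have -> : #|{perm 'I_n}| = #|'S_(n)| by apply: eq_card.
  by rewrite mulr_natl mulr2n opprD addrA subrr add0r addNr.
have ge y : true -> 0 <= (Y y - psi y) ^+ 2.
  move=> _; rewrite real_exprn_even_ge0 //.
  by rewrite rpredB ?young_char_real ?frobenius_char_real.
have := psumr_eq0P ge E; move=> /(_ x isT)/eqP.
by rewrite expf_eq0 /= subr_eq0 => /eqP.
Qed.

(** The pairing is a coefficient of the characteristic times the alternant of [delta]. The product
    of two complete polynomials becomes two-row alternants, x_t^k shifts the exponent by k at t, and
    summing over t gives the border strip signs. *)
Lemma cycle_weight_pairing k : (1 <= k <= n)%N ->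
  \sum_x (alphak k x * 2 ^ alpha x)%N%:R * psi x = n`!%:R * acoef C n la k.
Proof.
move=> hk; have [k0 kn] := andP hk; have n0 : (0 < n)%N by apply: leq_trans kn.
have -> : \sum_x (alphak k x * 2 ^ alpha x)%N%:R * psi x =
    (Delta * \sum_x (alphak k x * 2 ^ alpha x)%N%:R *: W x)@_u.
  rewrite mulr_sumr raddf_sum; apply: eq_bigr => x _.
  by rewrite /= -scalerAr mcoeffZ.
rewrite frobenius_cycles // -scalerAr mcoeffZ /acoef -[LHS]mulrA; congr (_ * (_ * _)).
rewrite mulr_sumr raddf_sum /=.
transitivity (\sum_(t | (k <= u t)%N) \sum_(ab : 'I_L * 'I_L |
    (ab.2 <= ab.1)%N && (ab.1 + ab.2 == n - k)%N) (ab.1 - ab.2 + 1)%N%:R *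
      (alternant C (delta n + rows2 n ab.1 ab.2)%MM)@_(u - U_(t) *+ k)%MM).
  rewrite [RHS]big_mkcond; apply: eq_bigr => t _.
  rewrite mulrCA mcoeffXM.
  have -> : (U_(t) *+ k <= u)%MM = (k <= u t)%N.
    apply/mnm_lepP/idP => [h|h i]; first by have := h t; rewrite mulmnE mnm1E eqxx mul1n.
    by rewrite mulmnE mnm1E; case: eqP => [<-|_]; rewrite ?mul1n ?mul0n.
  case: ifP => // _; rewrite two_row_expansion ?leq_subr // raddf_sum.
  by apply: eq_bigr => ab _; rewrite /= mcoeffZ.
rewrite exchange_big /= big_mkcond [RHS]big_mkcond; apply: eq_bigr => -[a b] _ /=.
rewrite /strip_pair /=; case: ifP => [/andP[ba /eqP abk]|]; last first.
  by rewrite andbA => ->.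
rewrite -mulr_sumr strip_coefficient // ?ba ?abk ?eqxx /=; last lia.
by case: ifP; rewrite ?mulr0.
Qed.
End FrobeniusFormula.

(** * The Fourier transform on the Specht module *)

Theorem theorem3 (C : numClosedFieldType) (n k : nat) (la : seq nat)
    (hla : is_partition n la) (hk : (1 <= k <= n)%N)
    (d : nat) (R : mx_representation C [set: 'S_n] d)
    (hR : mx_rsim R (specht_repr C n la)) :
  fourier (fun s : 'S_n => (alphak k s * 2 ^ alpha s)%N%:R) R
  = (n`!%:R / d%:R * acoef C n la k) *: 1%:M.
Proof.
set f := fun s : 'S_n => _.
set c := young_symmetrizer C n la.
have fJ x y : f (x ^ y)%g = f x by rewrite /f alphak_conjg alpha_conjg.
have cardS : #|[set: 'S_n]| = n`! by rewrite cardsT -card_Sn; apply: eq_card.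
case: hR => B dE freeB homB.
have rk : \rank (left_mult c) = d.
  rewrite dE; set U := cyclic_mx _ _.
  by rewrite /U cyclic_left_mult genmxE.
have kd : hook_scalar C n la = n`!%:R / d%:R.
  have h := hook_scalar_rank C hla; rewrite -/c rk cardS in h.
  have d0 : (d%:R : C) != 0.
    apply: contraTneq (natN_neq0 C 'S_n) => d0.
    by rewrite -cardS in h; rewrite -h d0 mulr0 eqxx.
  by rewrite -h mulfK.
(* As f is a class function, c may be averaged over conjugates, which gives kappa times
   [young_char], hence kappa times the Frobenius coefficients; the n! from averaging cancels the one
   in [cycle_weight_pairing]. *)
have gamma : \sum_g f g * coef c g = n`!%:R / d%:R * acoef C n la k.
  have k0 := hook_scalar_neq0 C hla.
  have := cycle_weight_pairing C hla hk.
  rewrite (eq_bigr (fun x => f x * young_char C la x)); last first.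
    by move=> x _; rewrite frobenius_formula.
  rewrite -kd => E; apply: (@mulfI _ n`!%:R).
    by rewrite pnatr_eq0 -lt0n fact_gt0.
  rewrite mulrCA -E [RHS]mulr_sumr.
  transitivity (\sum_x \sum_(g : 'S_n) f (x ^ g)%g * coef c (x ^ g)%g); last first.
    apply: eq_bigr => x _; rewrite mulrCA mulVKf // mulr_sumr.
    by apply: eq_bigr => g _; rewrite fJ.
  rewrite [RHS]exchange_big /= [RHS](eq_bigr (fun=> \sum_x f x * coef c x)) => [|g _].
    by rewrite sumr_const -cardS cardsT mulr_natl.
  by rewrite [RHS](reindex_inj (conjg_inj g)).
rewrite -gamma; set gam := \sum_g _.
(* The intertwiner B is cancelled on the right to move the claim to the Specht module. *)
apply: (row_free_inj freeB) => /=.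
rewrite /fourier mulmx_suml (eq_bigr (fun s => B *m (f s *: specht_repr C n la s))); last first.
  by move=> s _; rewrite -scalemxAl homB ?in_setT // scalemxAr.
rewrite -mulmx_sumr -scalemxAl mul1mx.
suff -> : \sum_s f s *: specht_repr C n la s = gam *: 1%:M by rewrite -scalemxAr mulmx1.
apply: val_submod_inj; rewrite linear_sum linearZ /=.
set V := val_submod 1%:M.
have sub : (V <= left_mult c)%MS.
  by apply: submx_trans (val_submodP _) _; rewrite cyclic_left_mult genmxE.
have -> : \sum_s val_submod (f s *: specht_repr C n la s) = V *m \sum_s f s *: rho C s.
  rewrite mulmx_sumr; apply: eq_bigr => s _.
  rewrite linearZ /= -scalemxAr; congr (_ *: _).
  by rewrite -[specht_repr C n la s]mul1mx val_submodJ ?in_setT.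
(* The module is spanned by the rows of [left_mult c], the products c g_i. The central sum moves
   past g_i and meets c, where [young_central] gives the scalar. *)
case/submxP: sub => D ->; rewrite -mulmxA scalemxAr; congr (_ *m _).
apply/row_matrixP => i; rewrite row_mul linearZ /= !rowK -mulmxA.
rewrite central_comm // mulmxA -gring_row_mul young_central //.
by rewrite linearZ /= scalemxAl.
Qed.
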